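(* Let $S(W,V)$ be a quasi-Lie scheme. If $F:\mathcal{V}\rightarrow C^\infty(\mathbb{R})$ is a quasi-Lie invariant of order $p$ for $S(W,V)$, with $[F(X)](t)=\varphi_F({\bf t}^p_tX)$, then $\varphi_F$ is a common first-integral of the Lie algebras $V_{\mathcal{J}^p}$ and $V_{\mathcal{T}^p}$ of fundamental vector fields corresponding to the Lie group actions $$\mathcal{J}^p:G\times T^pV\to T^pV,\qquad (g;{\bf t}^p_{t_0}X=(X_0,\ldots,X_p))\mapsto {\bf t}^p_{t_0}(g_*X)=(g_*X_0,\ldots,g_*X_p),$$ $$\mathcal{T}^p:T^p_{p-1}W\times T^pV\to T^pV,\qquad ({\bf t}^p_{t_0}Y;{\bf t}^p_{t_0}X)\mapsto{\bf t}^p_{t_0}(Y+X),$$ where $G$ is a connected Lie group with Lie algebra $T_eG\simeq W$, and $T^p_{p-1}W$ is the Abelian Lie group of those ${\bf t}^p_{t_0}Y\in T^pW$ such that ${\bf t}^{p-1}_{t_0}Y=0$.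
   Context: All objects are smooth and global. A quasi-Lie scheme $S(W,V)$ consists of finite-dimensional real vector spaces $W,V$ of vector fields on $\mathbb{R}^n$ with $[W,W]\subset W\subset V$ and $[W,V]\subset V$. $\mathcal{V}$ (resp. $\mathcal{W}$) is the family of $t$-dependent vector fields $X=\{X_t\}_{t\in\mathbb{R}}$ with $X_t\in V$ (resp. $X_t\in W$) for all $t$. $\mathcal{G}_W$ is the group of generalised flows $g=\{g_t\}$ of elements of $\mathcal{W}$, i.e. of curves in the connected Lie group $G$ with Lie algebra $\simeq W$ acting on $\mathbb{R}^n$ with $W$ as Lie algebra of fundamental vector fields; it acts on $\mathcal{V}$ by $(g_\bigstar X)_t=\frac{\partial g_t}{\partial t}\circ g_t^{-1}+g_{t*}X_t$. A quasi-Lie invariant is a map $F:\mathcal{V}\to C^\infty(\mathbb{R})$ with $F(g_\bigstar X)=F(X)$ for all $g\in\mathcal{G}_W$, $X\in\mathcal{V}$. For a curve $X:t\mapsto X_t$ in the vector space $V$, ${\bf t}^p_tX=(X_t,dX_t/dt,\ldots,d^pX_t/dt^p)\in T^pV\simeq V^{p+1}$ is its $p$-order tangent vector at $t$; $T^pV$ is the $p$-order tangent space to $V$, and similarly $T^pW\subset T^pV$. A quasi-Lie invariant $F$ is of order $p$ if there is a function $\varphi_F:T^pV\to\mathbb{R}$ (then unique) with $[F(X)](t)=\varphi_F({\bf t}^p_tX)$ for all $t$ and all $X\in\mathcal{V}$. A first-integral of a vector field is a function annihilated by it. *)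

(* Defs.v *)
From HB Require Import structures.
From mathcomp Require Import all_boot all_order all_algebra.
From mathcomp Require Import all_classical all_reals all_analysis.

Set Implicit Arguments.
Unset Strict Implicit.
Unset Printing Implicit Defensive.

Import Order.TTheory GRing.Theory Num.Theory numFieldNormedType.Exports.

Local Open Scope classical_set_scope.
Local Open Scope ring_scope.

Section Smooth.
Context {R : realType} {U U' : normedModType R}.

(* Used for finite-dimensional U and U' and open D only, where the values of
   'D_v f on D depend on f on D only, and where having continuous iterated
   directional derivatives of all orders is the usual C^oo. *)
Fixpoint Ck_on (k : nat) (D : set U) (f : U -> U') : Prop :=
  if k is k'.+1
  then (forall x, D x -> differentiable f x) /\
       (forall v : U, Ck_on k' D ('D_v f))
  else forall x, D x -> continuous_at x f.

Definition smooth_on (D : set U) (f : U -> U') : Prop := forall k, Ck_on k D f.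

Definition smooth (f : U -> U') : Prop := smooth_on setT f.

End Smooth.

Section VectorFields.
Context {R : realType} {n : nat}.

Definition vfield : Type := 'rV[R]_n -> 'rV[R]_n.

Definition bracket (X Y : vfield) : vfield :=
  fun x => 'D_(X x) Y x - 'D_(Y x) X x.

Definition pushforward (f finv : 'rV[R]_n -> 'rV[R]_n) (X : vfield) : vfield :=
  fun x => 'D_(X (finv x)) f (finv x).

Definition findim_space (V : set vfield) : Prop :=
  (exists (m : nat) (e : 'I_m -> vfield),
     V = [set X | exists c : 'I_m -> R, X = \sum_(i < m) c i *: e i]) /\
  (forall X, V X -> smooth X).

Definition quasi_lie_scheme (W V : set vfield) : Prop :=
  [/\ findim_space W /\ findim_space V,
      forall X Y, W X -> W Y -> W (bracket X Y),
      W `<=` V &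
      forall X Y, W X -> V Y -> V (bracket X Y)].

Definition tdep_field (V : set vfield) (X : R -> vfield) : Prop :=
  smooth (fun tx : R * 'rV[R]_n => X tx.1 tx.2) /\ forall t, V (X t).

(* g is the generalised flow of some Y with values in W; h t is the inverse
   diffeomorphism of g t. *)
Definition generalised_flow (W : set vfield) (g h : R -> 'rV[R]_n -> 'rV[R]_n)
    : Prop :=
  [/\ smooth (fun tx : R * 'rV[R]_n => g tx.1 tx.2),
      smooth (fun tx : R * 'rV[R]_n => h tx.1 tx.2),
      forall t, cancel (g t) (h t) /\ cancel (h t) (g t),
      forall x, g 0 x = x &
      exists2 Y, tdep_field W Y &
        forall t x, is_derive t (1 : R) (fun s => g s x) (Y t (g t x))].

Definition star (g h : R -> 'rV[R]_n -> 'rV[R]_n) (X : R -> vfield)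
    : R -> vfield :=
  fun t x => derive1 (fun s => g s (h t x)) t + pushforward (g t) (h t) (X t) x.

(* Maps defined on t-dependent vector fields with values in V are represented
   by total maps, whose values elsewhere are irrelevant. *)
Definition quasi_lie_invariant (W V : set vfield)
    (F : (R -> vfield) -> (R -> R)) : Prop :=
  (forall X, tdep_field V X -> smooth (F X)) /\
  (forall g h X, generalised_flow W g h -> tdep_field V X ->
     F (star g h X) = F X).

(* T^p V, identified with V^(p+1). *)
Definition jet_space (p : nat) (V : set vfield) : set ('I_p.+1 -> vfield) :=
  [set q | forall k, V (q k)].

Definition jet (p : nat) (X : R -> vfield) (t : R) : 'I_p.+1 -> vfield :=
  fun k x => derive1n k (fun s => X s x) t.
Arguments jet : clear implicits.

(* Smoothness on the finite-dimensional space V^(p+1), tested through the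
   linear parametrisations of V^(p+1) by finite families of elements of V. *)
Definition smooth_on_jets (p : nat) (V : set vfield)
    (phi : ('I_p.+1 -> vfield) -> R) : Prop :=
  forall (m : nat) (e : 'I_m -> vfield), (forall i, V (e i)) ->
    smooth (fun c : 'M[R]_(p.+1, m) =>
      (phi (fun k => \sum_(i < m) c k i *: e i) : R)).

Definition has_order (p : nat) (V : set vfield) (F : (R -> vfield) -> (R -> R))
    (phi : ('I_p.+1 -> vfield) -> R) : Prop :=
  smooth_on_jets V phi /\
  forall X, tdep_field V X -> forall t, F X t = phi (jet p X t).

(* phi is annihilated by the vector field Z on T^p V; since T^p V is a vector
   space, Z q is identified with an element of it. *)
Definition first_integral (p : nat) (V : set vfield)
    (Z : ('I_p.+1 -> vfield) -> ('I_p.+1 -> vfield))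
    (phi : ('I_p.+1 -> vfield) -> R) : Prop :=
  forall q, jet_space V q ->
    jet_space V (Z q) /\
    is_derive (0 : R) (1 : R) (fun s : R => phi (q + s *: Z q) : R) 0.

(* The fundamental vector field of an action of a one-parameter group on
   T^p V.  The derivative in s of a curve in the finite-dimensional space V is
   computed at each point x. *)
Definition jet_fundamental (p : nat)
    (a : R -> ('I_p.+1 -> vfield) -> ('I_p.+1 -> vfield))
    : ('I_p.+1 -> vfield) -> ('I_p.+1 -> vfield) :=
  fun q k x => derive1 (fun s => a s q k x) 0.

(* T^p_(p-1) W *)
Definition vertical_jets (p : nat) (W : set vfield)
    : set ('I_p.+1 -> vfield) :=
  [set Y | jet_space W Y /\ forall k : 'I_p.+1, (k < p)%N -> Y k = 0].

Definition vertical_act (p : nat) (Y q : 'I_p.+1 -> vfield)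
    : 'I_p.+1 -> vfield := Y + q.

(* The one-parameter subgroups of the vector group T^p_(p-1) W are the maps
   s |-> s *: Y. *)
Definition VT (p : nat) (W : set vfield)
    : set (('I_p.+1 -> vfield) -> ('I_p.+1 -> vfield)) :=
  [set Z | exists2 Y, vertical_jets W Y &
             Z = jet_fundamental (fun s => vertical_act (s *: Y))].

End VectorFields.

Arguments vfield : clear implicits.
Arguments jet {R n} p X t _ _.
Arguments VT {R n} p W _.

#[short(type="topGroupType")]
HB.structure Definition TopGroup := {G of Group G & Topological G}.

Section Charts.
Context {R : realType}.

(* coord and param are mutually inverse homeomorphisms between cdom and
   coord @` cdom; their values elsewhere are irrelevant. *)
Record chart (M : topologicalType) (d : nat) := Chart {
  cdom : set M;
  coord : M -> 'rV[R]_d;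
  param : 'rV[R]_d -> M;
  open_cdom : open cdom;
  open_cimg : open (coord @` cdom);
  coordK : forall x, cdom x -> param (coord x) = x;
  coord_continuous : forall x, cdom x -> continuous_at x coord;
  param_continuous : forall u, (coord @` cdom) u -> continuous_at u param }.

Definition cimg (M : topologicalType) (d : nat) (c : chart M d) : set 'rV[R]_d :=
  coord c @` cdom c.

Definition smooth_into (M : topologicalType) (d : nat) (A : set (chart M d))
    (U : normedModType R) (D : set U) (f : U -> M) : Prop :=
  (forall x, D x -> continuous_at x f) /\
  (forall c, A c -> smooth_on (D `&` f @^-1` cdom c) (coord c \o f)).

Record smooth_manifold (M : topologicalType) (d : nat) (A : set (chart M d))
    : Prop := SmoothManifold {
  manifold_hausdorff : hausdorff_space M;
  manifold_countable : @second_countable M;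
  manifold_cover : forall x : M, exists2 c, A c & cdom c x;
  (* the transition maps coord c' \o param c are smooth *)
  manifold_transition : forall c, A c -> smooth_into A (cimg c) (param c) }.

Record lie_group (G : topGroupType) (d : nat) (A : set (chart G d))
    : Prop := LieGroup {
  lie_manifold : smooth_manifold A;
  lie_mul : forall c c', A c -> A c' ->
    smooth_into A (cimg c `*` cimg c')
      (fun uv => (param c uv.1 * param c' uv.2)%g);
  lie_inv : forall c, A c ->
    smooth_into A (cimg c) (fun u => ((param c u)^-1)%g) }.

Definition one_parameter_subgroup (G : topGroupType) (d : nat)
    (A : set (chart G d)) (gamma : R -> G) : Prop :=
  smooth_into A setT gamma /\
  forall s t, gamma (s + t) = (gamma s * gamma t)%g.

Record smooth_action (G : topGroupType) (d : nat) (A : set (chart G d))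
    (n : nat) (Phi : G -> 'rV[R]_n -> 'rV[R]_n) : Prop := SmoothAction {
  action1 : forall x, Phi 1%g x = x;
  actionM : forall g h x, Phi (g * h)%g x = Phi g (Phi h x);
  action_smooth : forall c, A c ->
    smooth_on (cimg c `*` setT)
      (fun ux : 'rV[R]_d * 'rV[R]_n => Phi (param c ux.1) ux.2) }.

Definition fundamental_field (G : topGroupType) (n : nat)
    (Phi : G -> 'rV[R]_n -> 'rV[R]_n) (gamma : R -> G) : vfield R n :=
  fun x => derive1 (fun s => Phi (gamma s) x) 0.

(* An element of T_e G is given by its one-parameter subgroup s |-> exp(s a).
   The map from T_e G to vector fields is then automatically linear (and a Lie
   algebra morphism up to sign), so that its being a bijection onto W says that
   T_e G is isomorphic to W through the fundamental vector fields. *)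
Definition has_lie_algebra (G : topGroupType) (d : nat) (A : set (chart G d))
    (n : nat) (Phi : G -> 'rV[R]_n -> 'rV[R]_n) (W : set (vfield R n)) : Prop :=
  set_bij [set gamma | one_parameter_subgroup A gamma] W
    (fundamental_field Phi).

Definition jet_act (G : topGroupType) (n : nat)
    (Phi : G -> 'rV[R]_n -> 'rV[R]_n) (p : nat) (g : G)
    (q : 'I_p.+1 -> vfield R n) : 'I_p.+1 -> vfield R n :=
  fun k => pushforward (Phi g) (Phi (g^-1)%g) (q k).

Definition VJ (G : topGroupType) (d : nat) (A : set (chart G d)) (n : nat)
    (Phi : G -> 'rV[R]_n -> 'rV[R]_n) (p : nat)
    : set (('I_p.+1 -> vfield R n) -> ('I_p.+1 -> vfield R n)) :=
  [set Z | exists2 gamma, one_parameter_subgroup A gamma &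
             Z = jet_fundamental (fun s => jet_act Phi (gamma s))].

End Charts.

Arguments chart : clear implicits.
Arguments VJ {R G d} A {n} Phi p _.

(* Main.v *)
(* The invariant determines a function phi of jets that takes the same value on
   the jet of X and on the jet of star g X at any time t0.  Let H be the
   one-parameter group generated by Y in W, and run it with a polynomial
   clock: g_t = H_(T t) with T 0 = 0 and T' divisible by (t - t0)^p.  Up to
   order p at t0 the clock T is frozen, so that the jet of star g X is the jet
   of X transported by H_(T t0), except that p! w(t0) Y is added to its top
   component, where T' = (t - t0)^p w.  With t0 = 1, T 1 = s and w 1 = 0 this
   says that phi is constant along the orbits of J^p; with t0 = 0 and
   T = s t^(p+1)/(p+1)! it says the same for T^p.

   That transport preserves V comes from the linear equation
   d/ds (H_s)_* X = (H_s)_* [X, Y], which ad Y : V -> V turns into a matrix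
   equation solved by a matrix exponential; the equation itself rests on the
   symmetry of second derivatives. *)
Require Import Defs.
From HB Require Import structures.
From mathcomp Require Import all_boot all_order all_algebra.
From mathcomp Require Import all_classical all_reals all_analysis.
From mathcomp Require Import ring lra.

Set Implicit Arguments.
Unset Strict Implicit.
Unset Printing Implicit Defensive.

Import Order.TTheory GRing.Theory Num.Theory numFieldNormedType.Exports.

Local Open Scope classical_set_scope.
Local Open Scope ring_scope.

(** * Scalar multiplication as a bilinear map *)

Section ScaleBilinear.
Context {R : realType} {V : normedModType R}.

(** Registered as a bilinear structure so that the differential of a bilinear map yields the product
    rule for [f y *: g y]. *)
Lemma scale_is_bilinear :
  bilinear_for
    (GRing.Scale.Law.clone _ _ *:%R _) (GRing.Scale.Law.clone _ _ *:%R _)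
    (@GRing.scale R V : R -> V -> V).
Proof.
split=> [u'|u] a x y /=; first by rewrite scalerDl scalerA.
by rewrite scalerDr !scalerA mulrC.
Qed.
HB.instance Definition _ := bilinear_isBilinear.Build R R V V _ _
  (@GRing.scale R V : R -> V -> V) scale_is_bilinear.

End ScaleBilinear.

(** * Calculus of maps of class C^k *)

Section Calculus.
Context {R : realType}.
Implicit Types U V W : normedModType R.

Lemma differentiable_scale U V (f : U -> R) (g : U -> V) (x : U) :
  differentiable f x -> differentiable g x ->
  differentiable (fun y => f y *: g y) x /\
  forall v, 'D_v (fun y => f y *: g y) x = 'D_v f x *: g x + f x *: 'D_v g x.
Proof.
move=> df dg.
have sc : continuous (fun p : R * V => p.1 *: p.2).
  exact: scale_continuous.
have dp : differentiable (fun y => (f y, g y)) x by exact: differentiable_pair.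
have ds : differentiable (fun p : R * V => p.1 *: p.2) (f x, g x).
  exact: (differentiable_bilin (f := (@GRing.scale R V : {bilinear R -> V -> V}))).
have dc : differentiable ((fun p : R * V => p.1 *: p.2) \o (fun y => (f y, g y))) x.
  exact: differentiable_comp.
split=> [//|v]; rewrite deriveE// (diff_comp dp ds)/=.
rewrite (diff_bilin (f := (@GRing.scale R V : {bilinear R -> V -> V})))//=.
by rewrite diff_pair//= !deriveE// addrC.
Qed.


(** The first-order expansion of [f] at [x] involves only nearby values, so it is also an expansion
    of [g]; uniqueness of the differential then identifies ['d g x] with ['d f x]. *)
Lemma near_eq_differentiable U V (f g : U -> V) (x : U) :
  (\forall y \near x, f y = g y) -> differentiable f x -> differentiable g x.
Proof.
move=> fg df.
have /diff_locally/eqaddoP dfo := df.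
have dgo : g \o shift x = cst (g x) + 'd f x +o_ 0 id.
  apply/eqaddoP => e e0; move: (dfo e e0); apply: filter_app.
  have : \forall h \near 0, f (h + x) = g (h + x).
    by move: fg; rewrite (near_shift 0) subr0.
  apply: filter_app; near=> h => fgh.
  change (`|f (h + x) - (f x + 'd f x h)| <= e * `|h| ->
          `|g (h + x) - (g x + 'd f x h)| <= e * `|h|).
  by rewrite fgh (nbhs_singleton fg).
have dgf : 'd g x = 'd f x :> (U -> V).
  by apply: diff_unique dgo; exact: diff_continuous.
apply/diff_locallyP; rewrite dgf; split=> //.
exact: diff_continuous.
Unshelve. all: by end_near. Qed.

(** Openness of [D] carries the agreement of [f] and [g] over to their directional derivatives,
    which keeps the induction going. Later lemmas use this to replace a derivative by its explicit
    formula. *)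
Lemma Ck_on_eq U V k (D : set U) (f g : U -> V) :
  open D -> (forall x, D x -> f x = g x) -> Ck_on k D f -> Ck_on k D g.
Proof.
move=> oD; elim: k f g => [|k IH] f g fg /=.
  move=> cf x Dx.
  have nfg : \forall y \near x, f y = g y.
    by apply: filterS (open_nbhs_nbhs (conj oD Dx)) => y /fg.
  rewrite /continuous_at -(fg _ Dx).
  apply: cvg_trans (cf x Dx); exact: near_eq_cvg.
case=> df Df; split=> [x Dx|v].
  apply: near_eq_differentiable (df x Dx).
  by apply: filterS (open_nbhs_nbhs (conj oD Dx)) => y /fg.
apply: IH (Df v) => x Dx; apply: near_eq_derive.
by apply: filterS (open_nbhs_nbhs (conj oD Dx)) => y /fg.
Qed.

Lemma Ck_onS U V k (D : set U) (f : U -> V) : Ck_on k.+1 D f -> Ck_on k D f.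
Proof.
elim: k f => [|k IH] f /= [df Df].
  by move=> x Dx; apply: differentiable_continuous; exact: df.
by split=> // v; exact: IH (Df v).
Qed.

Lemma Ck_on_sub U V k (D E : set U) (f : U -> V) :
  E `<=` D -> Ck_on k D f -> Ck_on k E f.
Proof.
move=> ED; elim: k f => [|k IH] f /=; first by move=> cf x /ED; exact: cf.
by move=> [df Df]; split=> [x /ED|v]; [exact: df|exact: IH].
Qed.

(** Serves to prove smoothness chart by chart. *)
Lemma Ck_on_local U V k (D : set U) (f : U -> V) :
  (forall x, D x -> exists2 E, E x & Ck_on k E f) -> Ck_on k D f.
Proof.
elim: k f => [|k IH] f loc /=.
  by move=> x /loc[E Ex /=]; exact.
split=> [x /loc[E Ex /= [df _]]|v]; first exact: df.
by apply: IH => x /loc[E Ex /= [_ Df]]; exists E.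
Qed.

Lemma Ck_on_cst U V k (D : set U) (a : V) : Ck_on k D (fun _ : U => a).
Proof.
elim: k a => [|k IH] a /=; first by move=> x _; exact: cst_continuous.
split=> [x _|v]; first exact: differentiable_cst.
by rewrite [derive _ ^~ _](_ : _ = fun=> 0)//; apply/funext => x; exact: derive_cst.
Qed.

Lemma derive_lin U V (l : {linear U -> V}) : continuous l ->
  forall x v, 'D_v l x = l v.
Proof.
by move=> cl x v; rewrite deriveE; [rewrite diff_lin|exact: linear_differentiable].
Qed.

Lemma Ck_on_lin U V k (D : set U) (l : {linear U -> V}) :
  continuous l -> Ck_on k D l.
Proof.
move=> cl; case: k => [|k] /=; first by move=> x _; exact: cl.
split=> [x _|v]; first exact: linear_differentiable.
rewrite [derive _ ^~ _](_ : _ = fun=> l v); first exact: Ck_on_cst.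
by apply/funext => x; exact: derive_lin.
Qed.

Lemma Ck_on_lin_comp U V W k (D : set U) (l : {linear V -> W}) (g : U -> V) :
  open D -> continuous l -> Ck_on k D g -> Ck_on k D (l \o g).
Proof.
move=> oD cl; elim: k g => [|k IH] g /=.
  by move=> cg x Dx; apply: continuous_comp; [exact: cg|exact: cl].
move=> [dg Dg]; split=> [x Dx|v].
  by apply: differentiable_comp; [exact: dg|exact: linear_differentiable].
apply: Ck_on_eq (IH _ (Dg v)) => // x Dx /=.
have dlg : differentiable l (g x) by exact: linear_differentiable.
have dgx := dg x Dx.
have dlgx : differentiable (l \o g) x by exact: differentiable_comp.
by rewrite !deriveE// (diff_comp dgx dlg)/= diff_lin.
Qed.

Lemma Ck_onD U V k (D : set U) (f g : U -> V) : open D ->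
  Ck_on k D f -> Ck_on k D g -> Ck_on k D (fun x => f x + g x).
Proof.
move=> oD; elim: k f g => [|k IH] f g /=.
  by move=> cf cg x Dx; apply: continuousD; [exact: cf|exact: cg].
move=> [df Df] [dg Dg]; split=> [x Dx|v].
  by apply: differentiableD; [exact: df|exact: dg].
apply: Ck_on_eq (IH _ _ (Df v) (Dg v)) => // x Dx.
rewrite [in RHS](_ : (fun x => f x + g x) = f + g)// deriveD//.
- by apply: diff_derivable; exact: df.
- by apply: diff_derivable; exact: dg.
Qed.

Lemma Ck_on_sum U V k (D : set U) (I : Type) (r : seq I) (f : I -> U -> V) :
  open D -> (forall i, Ck_on k D (f i)) ->
  Ck_on k D (fun x => \sum_(i <- r) f i x).
Proof.
move=> oD fk; elim: r => [|i r IH].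
  apply: Ck_on_eq (Ck_on_cst k D 0) => // x _; by rewrite big_nil.
apply: Ck_on_eq (Ck_onD oD (fk i) IH) => // x _; by rewrite big_cons.
Qed.

Lemma Ck_onZ U V k (D : set U) (f : U -> R) (g : U -> V) : open D ->
  Ck_on k D f -> Ck_on k D g -> Ck_on k D (fun x => f x *: g x).
Proof.
move=> oD; elim: k f g => [|k IH] f g.
  by move=> cf cg x Dx; apply: continuousZ; [exact: cf|exact: cg].
move=> fk gk; have [df Df] := fk; have [dg Dg] := gk; split=> [x Dx|v].
  by have [] := differentiable_scale (df x Dx) (dg x Dx).
have := Ck_onD oD (IH _ _ (Df v) (Ck_onS gk)) (IH _ _ (Ck_onS fk) (Dg v)).
apply: Ck_on_eq => // x Dx.
by have [_ ->] := differentiable_scale (df x Dx) (dg x Dx).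
Qed.

(** A finite family [b] with continuous linear forms [l] as coordinates: exactly the expansion that
    the chain rule and the reduction to real-valued maps use. *)
Definition findim U := exists (I : finType) (b : I -> U) (l : I -> {linear U -> R}),
  (forall i, continuous (l i)) /\ forall u, u = \sum_i l i u *: b i.

(* The finite basis of the intermediate space V writes the directional
   derivatives of f o g through the finitely many 'D_(b i) f, which the
   induction on k can handle. *)
Lemma Ck_on_comp U V W k (D : set U) (E : set V) (f : V -> W) (g : U -> V) :
  findim V -> open D -> (forall x, D x -> E (g x)) ->
  Ck_on k E f -> Ck_on k D g -> Ck_on k D (fun x => f (g x)).
Proof.
move=> [I [b [l [cl bl]]]] oD DE; elim: k f g DE => [|k IH] f g DE.
  by move=> cf cg x Dx; apply: continuous_comp; [exact: cg|exact/cf/DE].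
move=> fk gk; have [df Df] := fk; have [dg Dg] := gk.
have dfg x : D x -> differentiable (f \o g) x.
  by move=> Dx; apply: differentiable_comp; [exact: dg|exact/df/DE].
split=> // v.
have : Ck_on k D (fun x => \sum_i l i ('D_v g x) *: 'D_(b i) f (g x)).
  apply: Ck_on_sum => // i; apply: Ck_onZ => //.
    exact: (Ck_on_lin_comp (l := l i) oD (@cl i) (Dg v)).
  exact: (IH ('D_(b i) f) g DE (Df (b i)) (Ck_onS gk)).
apply: Ck_on_eq => // x Dx.
have dfgx := df _ (DE _ Dx); have dgx := dg x Dx; have dfgx' := dfg x Dx.
rewrite (deriveE v dfgx') (diff_comp dgx dfgx)/= -(deriveE v dgx).
rewrite [in RHS](bl ('D_v g x)) linear_sum; apply: eq_bigr => i _.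
by rewrite linearZ /= (deriveE _ dfgx).
Qed.

End Calculus.

(** * Finite-dimensional normed spaces *)

Section FiniteDimension.
Context {R : realType}.

Lemma findim_R : findim (R : normedModType R).
Proof.
exists unit, (fun=> 1), (fun=> idfun); split=> [_ x|u]; first exact: cvg_id.
by rewrite (big_pred1 tt)/=; [rewrite /GRing.scale/= mulr1|case].
Qed.

Lemma findim_mx m n : findim ('M[R]_(m, n)).
Proof.
exists ('I_m * 'I_n)%type, (fun ij => delta_mx ij.1 ij.2).
have lin (ij : 'I_m * 'I_n) : linear (fun M : 'M[R]_(m, n) => M ij.1 ij.2).
  by move=> a u v; rewrite !mxE.
pose L ij : {linear 'M[R]_(m, n) -> R} :=
  HB.pack (fun M : 'M[R]_(m, n) => M ij.1 ij.2)
    (GRing.isLinear.Build _ _ _ _ _ (lin ij)).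
exists L; split=> [ij|u]; first exact: coord_continuous.
by rewrite [LHS]matrix_sum_delta pair_bigA.
Qed.

Lemma findim_prod (U V : normedModType R) : findim U -> findim V ->
  findim (U * V)%type.
Proof.
move=> [I [b [l [cl bl]]]] [J [b' [l' [cl' bl']]]].
exists (I + J)%type,
  (fun ij => match ij with inl i => (b i, 0) | inr j => (0, b' j) end).
pose f (ij : I + J) (uv : U * V) :=
  match ij with inl i => l i uv.1 | inr j => l' j uv.2 end.
have lin ij : linear (f ij) by case: ij => i a u v; rewrite /f linearP.
pose L ij : {linear (U * V)%type -> R} :=
  HB.pack (f ij) (GRing.isLinear.Build _ _ _ _ _ (lin ij)).
exists L; split=> [[i|j] x|[u v]].
- apply: (@continuous_comp _ _ _ fst (l i)); [exact: cvg_fst|exact: cl].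
- apply: (@continuous_comp _ _ _ snd (l' j)); [exact: cvg_snd|exact: cl'].
rewrite big_sumType/= [in LHS](bl u) [in LHS](bl' v).
have -> : \sum_i l i u *: (b i, 0 : V) = (\sum_i l i u *: b i, 0).
  apply/esym; elim/big_rec2 : _ => [//|i y1 y2 _ <-].
  by rewrite -[RHS]/(l i u *: b i + y2, l i u *: 0 + 0) scaler0 addr0.
have -> : \sum_i l' i v *: (0 : U, b' i) = (0, \sum_i l' i v *: b' i).
  apply/esym; elim/big_rec2 : _ => [//|i y1 y2 _ <-].
  by rewrite -[RHS]/(l' i v *: 0 + 0, l' i v *: b' i + y2) scaler0 addr0.
by rewrite -[RHS]/(_ + 0, 0 + _) addr0 add0r.
Qed.

End FiniteDimension.

(** * Smooth maps on whole spaces *)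

Section SmoothMaps.
Context {R : realType}.
Implicit Types U V W : normedModType R.

Lemma derive_comp U V W (f : V -> W) (g : U -> V) (x v : U) :
  differentiable g x -> differentiable f (g x) ->
  is_derive x v (fun y => f (g y)) ('D_('D_v g x) f (g x)).
Proof.
move=> dg df; have dfg : differentiable (f \o g) x by exact: differentiable_comp.
apply: DeriveDef; first exact: diff_derivable.
by rewrite (deriveE v dfg) (diff_comp dg df)/= -(deriveE v dg) (deriveE _ df).
Qed.

Lemma is_derive_curve V W (f : V -> W) (g : R -> V) (t : R) (dg : V) :
  is_derive t 1 g dg -> differentiable f (g t) ->
  is_derive t 1 (fun s => f (g s)) ('D_dg f (g t)).
Proof.
move=> [dgt <-] df; apply: derive_comp => //; exact/derivable1_diffP.
Qed.

Lemma is_derive_lin U V W (l : {linear V -> W}) (g : U -> V) (x v : U) (dg : V) :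
  continuous l -> is_derive x v g dg -> is_derive x v (fun y => l (g y)) (l dg).
Proof.
move=> cl gd.
have [dgx <-] := gd.
pose k (h : R) := h^-1 *: ((g \o shift x) (h *: v) - g x).
have kl : (fun h : R => h^-1 *: (((l \o g) \o shift x) (h *: v) - (l \o g) x)) =
    l \o k.
  by apply/funext => h; rewrite /k /= linearZ/=; congr (_ *: _); rewrite linearB.
have kc : l \o k @ 0^' --> l ('D_v g x).
  have kd : k @ 0^' --> 'D_v g x by exact: dgx.
  exact: (cvg_comp _ _ kd (cl _)).
apply: DeriveDef; first by rewrite /derivable kl; apply/cvg_ex; eexists; exact: kc.
by rewrite /derive kl; exact: cvg_lim kc.
Qed.

Lemma smooth_differentiable U V (f : U -> V) x : smooth f -> differentiable f x.
Proof. by move=> /(_ 1)[+ _]; exact. Qed.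

Lemma smooth_derive U V (f : U -> V) v : smooth f -> smooth ('D_v f).
Proof. by move=> sf k; have [_] := sf k.+1; exact. Qed.

Lemma smooth_continuous U V (f : U -> V) : smooth f -> continuous f.
Proof.
by move=> sf x; apply: differentiable_continuous; exact: smooth_differentiable.
Qed.

Lemma smooth_is_derive U V (f : U -> V) x v : smooth f -> is_derive x v f ('D_v f x).
Proof.
by move=> sf; apply/derivableP/diff_derivable; exact: smooth_differentiable.
Qed.

Lemma smooth_cst U V (a : V) : smooth (fun _ : U => a).
Proof. by move=> k; exact: Ck_on_cst. Qed.

Lemma smooth_lin U V (l : {linear U -> V}) : continuous l -> smooth l.
Proof. by move=> cl k; exact: Ck_on_lin. Qed.

Lemma smoothD U V (f g : U -> V) :
  smooth f -> smooth g -> smooth (fun x => f x + g x).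
Proof. by move=> sf sg k; apply: Ck_onD => //; exact: openT. Qed.

Lemma smooth_sum U V (I : Type) (r : seq I) (f : I -> U -> V) :
  (forall i, smooth (f i)) -> smooth (fun x => \sum_(i <- r) f i x).
Proof. by move=> sf k; apply: Ck_on_sum => [|i]; [exact: openT|exact: sf]. Qed.

Lemma smoothZ U V (f : U -> R) (g : U -> V) :
  smooth f -> smooth g -> smooth (fun x => f x *: g x).
Proof. by move=> sf sg k; apply: Ck_onZ => //; exact: openT. Qed.

Lemma smoothM U (f g : U -> R) :
  smooth f -> smooth g -> smooth (fun x => f x * g x).
Proof. exact: smoothZ. Qed.

Lemma smooth_comp U V W (f : V -> W) (g : U -> V) :
  findim V -> smooth f -> smooth g -> smooth (fun x => f (g x)).
Proof.
move=> fV sf sg k; apply: (@Ck_on_comp _ _ _ _ _ setT setT) => //; exact: openT.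
Qed.

Lemma derive_pair U V W (f : U -> V) (g : U -> W) (x v : U) :
  differentiable f x -> differentiable g x ->
  'D_v (fun y => (f y, g y)) x = ('D_v f x, 'D_v g x).
Proof.
move=> df dg; have dp : differentiable (fun y => (f y, g y)) x.
  exact: differentiable_pair.
by rewrite (deriveE v dp) diff_pair//= (deriveE v df) (deriveE v dg).
Qed.

Lemma Ck_on_pair U V W k (D : set U) (f : U -> V) (g : U -> W) : open D ->
  Ck_on k D f -> Ck_on k D g -> Ck_on k D (fun x => (f x, g x)).
Proof.
move=> oD; elim: k f g => [|k IH] f g /=.
  by move=> cf cg x Dx; apply: cvg_pair; [exact: cf|exact: cg].
move=> [df Df] [dg Dg]; split=> [x Dx|v].
  by apply: differentiable_pair; [exact: df|exact: dg].
apply: Ck_on_eq (IH _ _ (Df v) (Dg v)) => // x Dx.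
by rewrite derive_pair; [|exact: df|exact: dg].
Qed.

Lemma smooth_pair U V W (f : U -> V) (g : U -> W) :
  smooth f -> smooth g -> smooth (fun x => (f x, g x)).
Proof. by move=> sf sg k; apply: Ck_on_pair => //; exact: openT. Qed.

Lemma smooth_fst U V : smooth (fst : U * V -> U).
Proof. by apply: (@smooth_lin _ _ fst) => x; exact: cvg_fst. Qed.

Lemma smooth_snd U V : smooth (snd : U * V -> V).
Proof. by apply: (@smooth_lin _ _ snd) => x; exact: cvg_snd. Qed.

Lemma smooth_id U : smooth (fun x : U => x).
Proof. by apply: (@smooth_lin _ _ idfun) => x; exact: cvg_id. Qed.

Lemma smooth_coord m n i j : smooth (fun M : 'M[R]_(m, n) => M i j).
Proof.
have lin : linear (fun M : 'M[R]_(m, n) => M i j) by move=> a u v; rewrite !mxE.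
pose L : {linear 'M[R]_(m, n) -> R} :=
  HB.pack (fun M : 'M[R]_(m, n) => M i j) (GRing.isLinear.Build _ _ _ _ _ lin).
apply: (@smooth_lin _ _ L); exact: coord_continuous.
Qed.

End SmoothMaps.

(** * Symmetry of second derivatives *)

Section Schwarz.
Context {R : realType}.
Implicit Types U V : normedModType R.

Lemma is_derive_line U V (f : U -> V) (c u : U) (a : R) : smooth f ->
  is_derive a 1 (fun s => f (c + s *: u)) ('D_u f (c + a *: u)).
Proof.
move=> sf; have du : is_derive a 1 (fun s : R => c + s *: u) u.
  have ds : is_derive a 1 (fun s : R => s *: u) u.
    have ds : differentiable (fun s : R => s *: u) a by [].
    apply: DeriveDef; first exact/derivable1_diffP.
    by rewrite deriveE// diff_val/= scale1r.
  by have := is_deriveD (is_derive_cst c a 1) ds; rewrite add0r.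
exact: (is_derive_curve du (smooth_differentiable _ sf)).
Qed.

(* Applied with u and v exchanged as well, this expresses one and the same
   difference by both mixed derivatives. *)
Let second_difference U (f : U -> R) (x u v : U) (h : R) : smooth f -> 0 < h ->
  exists a b, [/\ 0 <= a <= h, 0 <= b <= h &
    f (x + h *: u + h *: v) - f (x + h *: u) - f (x + h *: v) + f x =
      h * (h * 'D_v ('D_u f) (x + a *: u + b *: v))].
Proof.
move=> sf h0.
(* The second difference equals [g h - g 0]. The mean value theorem for [g] gives [a]; the value
   [g' a] is itself an increment, of [k] below, and a second application gives [b]. *)
pose g a := f (x + h *: v + a *: u) - f (x + a *: u).
have gd (a : R) : is_derive a 1 g
    ('D_u f (x + h *: v + a *: u) - 'D_u f (x + a *: u)).
  by apply: is_deriveB; exact: is_derive_line.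
have gc : {within `[0, h], continuous g}.
  apply: continuous_subspaceT => a; apply: differentiable_continuous.
  by apply/derivable1_diffP; have [] := gd a.
have [a /[!in_itv]/= /andP[a0 ah] ga] := MVT h0 (fun a _ => gd a) gc.
pose k b := 'D_u f (x + a *: u + b *: v).
have kd (b : R) : is_derive b 1 k ('D_v ('D_u f) (x + a *: u + b *: v)).
  by apply: is_derive_line; exact: smooth_derive.
have kc : {within `[0, h], continuous k}.
  apply: continuous_subspaceT => b; apply: differentiable_continuous.
  by apply/derivable1_diffP; have [] := kd b.
have [b /[!in_itv]/= /andP[b0 bh] kb] := MVT h0 (fun b _ => kd b) kc.
exists a, b; split; [by rewrite !ltW|by rewrite !ltW|].
move: ga kb; rewrite /g /k !subr0 !scale0r !addr0 => ga kb.
rewrite [h * (h * _)]mulrC.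
rewrite [h * 'D_v _ _]mulrC -kb.
rewrite [x + a *: u + h *: v]addrAC -ga [x + h *: u + h *: v]addrAC.
lra.
Qed.

(** Both mixed derivatives, taken at points that tend to [x] with [h], equal the same second
    difference divided by [h * h]; continuity of the second derivatives concludes. *)
Let schwarz_real U (f : U -> R) (x u v : U) : smooth f ->
  'D_v ('D_u f) x = 'D_u ('D_v f) x.
Proof.
move=> sf; apply/eqP; rewrite -subr_eq0 -normr_le0.
apply/ler_addgt0Pr => e e0; rewrite add0r.
(* The summand 1 keeps [M] positive even when [u] and [v] vanish, so that [h] can be chosen below a
   quotient by [M]. *)
pose M := `|u| + `|v| + 1.
have M0 : 0 < M by rewrite ltr_wpDl// addr_ge0.
have near_x (g : U -> R) : smooth g -> \forall h \near (0 : R)^'+,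
    forall y, `|y - x| <= h * M -> `|g x - g y| <= e / 2.
  move=> /smooth_continuous/(_ x)/cvgrPdist_le/(_ (e / 2)).
  rewrite divr_gt0// => /(_ isT)/nbhs_ballP[d/= d0 dg].
  near=> h => y yx; apply: dg; rewrite -ball_normE/= distrC (le_lt_trans yx)//.
  rewrite -ltr_pdivlMr//; near: h; apply: nbhs_right_lt; exact: divr_gt0.
have N1 := near_x _ (smooth_derive v (smooth_derive u sf)).
have N2 := near_x _ (smooth_derive u (smooth_derive v sf)).
have [h [[close1 close2] h0]] := filter_ex (filterI (filterI N1 N2) (nbhs_right_gt 0)).
have close a b u' v' : `|u'| + `|v'| <= M -> 0 <= a <= h -> 0 <= b <= h ->
    `|x + a *: u' + b *: v' - x| <= h * M.
  move=> uvM /andP[a0 ah] /andP[b0 bh].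
  rewrite -[x + _ + _]addrA [x + _]addrC addrK (le_trans (ler_normD _ _))//.
  rewrite !normrZ !ger0_norm// (@le_trans _ _ (h * (`|u'| + `|v'|)))//.
    by rewrite mulrDr lerD// ler_wpM2r.
  by rewrite ler_wpM2l// ltW.
have [a [b [ah bh E1]]] := second_difference x u v sf h0.
have [a' [b' [ah' bh' E2]]] := second_difference x v u sf h0.
have uv1 : `|u| + `|v| <= M by rewrite lerDl.
have uv2 : `|v| + `|u| <= M by rewrite addrC lerDl.
have := close1 _ (close a b u v uv1 ah bh).
have := close2 _ (close a' b' v u uv2 ah' bh').
move: E1 E2; rewrite [x + h *: v + h *: u]addrAC.
move: ('D_v ('D_u f) (x + _ + _)) ('D_u ('D_v f) (x + _ + _)) => r s.
move: ('D_v _ x) ('D_u _ x) => r0 s0 E1 E2.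
have -> : r = s.
  apply: (mulfI (lt0r_neq0 h0)); apply: (mulfI (lt0r_neq0 h0)).
  by rewrite -E1 -E2 [_ - f (x + h *: u) - _]addrAC.
rewrite !ler_norml => /andP[? ?] /andP[? ?]; apply/andP; split; lra.
Unshelve. all: by end_near. Qed.

(** The mean value theorem needs real values, so the claim is checked on each coordinate form [l i],
    which commutes with derivatives. *)
Lemma schwarz U V (f : U -> V) (x u v : U) : findim V -> smooth f ->
  'D_v ('D_u f) x = 'D_u ('D_v f) x.
Proof.
move=> [I [b [l [cl bl]]]] sf.
suff lE i : l i ('D_v ('D_u f) x) = l i ('D_u ('D_v f) x).
  move: lE; move: ('D_v _ x) ('D_u _ x) => a c lE.
  by rewrite (bl a) (bl c); under eq_bigr do rewrite lE.
have lD w (g : U -> V) y : smooth g -> 'D_w (l i \o g) y = l i ('D_w g y).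
  by move=> sg; have [] := is_derive_lin (@cl i) (smooth_is_derive y w sg).
have lDf w : 'D_w (l i \o f) = l i \o 'D_w f by apply/funext => y /=; exact: lD.
rewrite -(lD _ _ _ (smooth_derive u sf)) -(lD _ _ _ (smooth_derive v sf)).
rewrite -!lDf; apply: schwarz_real => k; apply: Ck_on_lin_comp => //.
exact: openT.
Qed.

End Schwarz.

(** * The matrix exponential *)

Section MatrixExponential.
Context {R : realType} {m : nat}.
Variable B : 'M[R]_m.

Let beta : R := \sum_i \sum_j `|B i j|.

Let beta_ge0 : 0 <= beta.
Proof. by do 2!apply: sumr_ge0 => ? _. Qed.

(** [beta] dominates each row sum of absolute values of [B], which makes the bound multiplicative.
    The exponential series of [beta * |x|] then dominates all the series below. *)
Let expmx_bound k i j : `|(B ^+ k) i j| <= beta ^+ k.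
Proof.
elim: k i j => [|k IH] i j.
  by rewrite !expr0 !mxE; case: eqP; rewrite ?normr1 ?normr0.
rewrite !exprS mxE (le_trans (ler_norm_sum _ _ _))//.
apply: (@le_trans _ _ (\sum_j `|B i j| * beta ^+ k)).
  by apply: ler_sum => l _; rewrite normrM ler_wpM2l.
rewrite -mulr_suml ler_wpM2r ?exprn_ge0// /beta [leRHS](bigD1 i)//= lerDl.
by do 2!apply: sumr_ge0 => ? _.
Qed.

(** Coefficients of the power series in [s] of the entry [(i, j)] of [B ^+ r] times the exponential
    of [s B]. Differentiating the series raises [r] by one. *)
Let coeff r i j k : R := (B ^+ (k + r)) i j / k`!%:R.

Let cvg_coeff r i j x : cvgn (pseries (coeff r i j) x).
Proof.
apply: normed_cvg.
apply: (@series_le_cvg _ _ (fun k => beta ^+ r * exp_coeff (beta * `|x|) k)).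
- by move=> k; exact: normr_ge0.
- move=> k; rewrite mulr_ge0 ?exprn_ge0// /exp_coeff divr_ge0// exprn_ge0//.
  by rewrite mulr_ge0.
- move=> k; rewrite /coeff /= !normrM normrX normfV [`|_%:R|]ger0_norm//.
  rewrite [leRHS](_ : _ = beta ^+ (k + r) / k`!%:R * `|x| ^+ k).
    by rewrite !ler_wpM2r ?expmx_bound ?exprn_ge0.
  by rewrite /exp_coeff /= exprMn exprD; move: (_^-1) => c; ring.
- by apply: is_cvg_seriesZ; exact: is_cvg_series_exp_coeff.
Qed.

Let E r s i j : R := limn (pseries (coeff r i j) s).

Let E_derive r (s : R) i j : is_derive s (1 : R) (fun s => E r s i j) (E r.+1 s i j).
Proof.
have diffs q : pseries_diffs (coeff q i j) = coeff q.+1 i j.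
  apply/funext => k; rewrite /pseries_diffs /coeff factS natrM invfM addSnnS.
  by rewrite mulrCA mulVKf.
(* Termwise differentiation requires the series and its first two derived series to converge at some
   point of modulus larger than [|s|]; here [|s| + 1]. *)
rewrite {2}/E -diffs; apply: (@pseries_snd_diffs _ _ (`|s| + 1)).
- exact: cvg_coeff.
- by rewrite diffs; exact: cvg_coeff.
- by rewrite !diffs; exact: cvg_coeff.
- by rewrite [ltRHS]ger0_norm ?ltrDl// addr_ge0.
Qed.

Let E_cvg r s i j : pseries (coeff r i j) s @ \oo --> E r s i j.
Proof. exact: cvg_coeff. Qed.

(** Already true for partial sums, where it is [B * B ^+ k = B ^+ k.+1], hence true in the limit.
    With the mirror image [E_mulmxr] it shows that [B] commutes with its exponential. *)
Let E_mulmx s i j : \sum_l B i l * E 0 s l j = E 1 s i j.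
Proof.
apply/esym/cvg_lim => //.
have -> : pseries (coeff 1 i j) s =
    (fun n => \sum_l B i l * pseries (coeff 0 l j) s n).
  apply/funext => n; rewrite /pseries /series/=.
  under [RHS]eq_bigr do rewrite mulr_sumr.
  rewrite exchange_big/=; apply: eq_bigr => k _.
  rewrite /coeff addn1 addn0 exprS [(B * _) i j]mxE !mulr_suml.
  by apply: eq_bigr => l _; rewrite !mulrA.
apply: cvg_big; [exact: add_continuous|move=> l _].
by apply: cvgM; [exact: cvg_cst|exact: E_cvg].
Qed.

Let E_mulmxr s i j : \sum_l E 0 s i l * B l j = E 1 s i j.
Proof.
apply/esym/cvg_lim => //.
have -> : pseries (coeff 1 i j) s =
    (fun n => \sum_l pseries (coeff 0 i l) s n * B l j).
  apply/funext => n; rewrite /pseries /series/=.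
  under [RHS]eq_bigr do rewrite mulr_suml.
  rewrite exchange_big/=; apply: eq_bigr => k _.
  rewrite /coeff addn1 addn0 exprSr [(_ * B) i j]mxE !mulr_suml.
  by apply: eq_bigr => l _; rewrite -!mulrA [B l j * _]mulrC !mulrA.
apply: cvg_big; [exact: add_continuous|move=> l _].
by apply: cvgM; [exact: E_cvg|exact: cvg_cst].
Qed.

Lemma matrix_exponential : exists Q : R -> 'M[R]_m,
  [/\ Q 0 = 1%:M, forall s, B *m Q s = Q s *m B &
    forall (s : R) i j, is_derive s (1 : R) (fun s => Q s i j) ((B *m Q s) i j)].
Proof.
exists (fun s => \matrix_(i, j) E 0 s i j); split.
- apply/matrixP => i j; rewrite [LHS]mxE; apply/cvg_lim => //.
  (* The empty partial sum is 0 and not the entry of the identity; the shift skips it and leaves a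
     constant sequence. *)
  rewrite -cvg_shiftS/=.
  rewrite (_ : (fun n => pseries (coeff 0 i j) 0 n.+1) =
      fun=> (1%:M : 'M[R]_m) i j); first exact: cvg_cst.
  apply/funext => n; rewrite /pseries /series/= big_nat_recl//=.
  rewrite big1 => [|k _]; last by rewrite expr0n/= mulr0.
  by rewrite /coeff expr0 fact0 !mulr1 divr1 addr0 expr0.
- move=> s; apply/matrixP => i j; rewrite !mxE.
  under eq_bigr do rewrite mxE; under [RHS]eq_bigr do rewrite mxE.
  by rewrite E_mulmx E_mulmxr.
- move=> s i j; rewrite mxE.
  under eq_bigr do rewrite mxE.
  rewrite E_mulmx [X in is_derive _ _ X](_ : _ = fun s => E 0 s i j)//.
  by apply/funext => t; rewrite mxE.
Qed.

End MatrixExponential.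

(** * Derivatives of curves *)

Section CurveDerivatives.
Context {R : realType}.
Implicit Types V : normedModType R.

Lemma is_derive_ext V (f g : R -> V) (t : R) (d : V) :
  is_derive t 1 f d -> f =1 g -> is_derive t 1 g d.
Proof. by move=> fd /funext <-. Qed.

Lemma is_derive_scale V (f : R -> R) (g : R -> V) (t df : R) (dg : V) :
  is_derive t 1 f df -> is_derive t 1 g dg ->
  is_derive t 1 (fun s => f s *: g s) (df *: g t + f t *: dg).
Proof.
move=> [dft <-] [dgt <-].
have [] := differentiable_scale ((derivable1_diffP f t).1 dft)
  ((derivable1_diffP g t).1 dgt).
move=> d <-; apply: DeriveDef => //; exact/derivable1_diffP.
Qed.

Lemma is_derive_fsum V (I : Type) (r : seq I) (f : I -> R -> V) (t : R) (d : I -> V) :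
  (forall i, is_derive t 1 (f i) (d i)) ->
  is_derive t 1 (fun s => \sum_(i <- r) f i s) (\sum_(i <- r) d i).
Proof.
move=> fd; elim: r => [|i r IH].
  rewrite big_nil; apply: (is_derive_ext (is_derive_cst 0 t 1)) => s.
  by rewrite big_nil.
rewrite big_cons; apply: (is_derive_ext (is_deriveD (fd i) IH)) => s.
by rewrite big_cons.
Qed.

Lemma is_derive_reparam V (f : R -> V) (g : R -> R) (t dg : R) (df : V) :
  is_derive t 1 g dg -> is_derive (g t) 1 f df ->
  is_derive t 1 (fun s => f (g s)) (dg *: df).
Proof.
move=> gd [dft <-]; have dff := (derivable1_diffP f (g t)).1 dft.
apply: (is_derive_eq (is_derive_curve gd dff)).
rewrite (deriveE _ dff) (deriveE _ dff) -linearZ/=.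
by congr ('d f (g t) _); rewrite /GRing.scale/= mulr1.
Qed.

Lemma is_derive_reverse V (f : R -> V) (t : R) (d : V) :
  is_derive (- t) 1 f d -> is_derive t 1 (fun s => f (- s)) (- d).
Proof.
by move=> fd; rewrite -scaleN1r; exact: (is_derive_reparam (is_deriveNid t (1 : R)) fd).
Qed.

Lemma derive1_is_derive V (f : R -> V) (t : R) (d : V) :
  is_derive t 1 f d -> derive1 f t = d.
Proof. by move=> [_ <-]; rewrite derive1E. Qed.

Lemma smooth_derive1 V (f : R -> V) : smooth f -> smooth (derive1 f).
Proof.
move=> /(smooth_derive (1 : R)); rewrite (_ : derive1 f = 'D_1 f)//.
by apply/funext => t; rewrite derive1E.
Qed.

Lemma smooth_derive1n V (f : R -> V) k : smooth f -> smooth (derive1n k f).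
Proof. by move=> sf; elim: k => [//|k IH]; rewrite derive1nS; exact: smooth_derive1. Qed.

Lemma smooth_is_derive1 V (f : R -> V) (t : R) :
  smooth f -> is_derive t 1 f (derive1 f t).
Proof. by move=> sf; rewrite derive1E; exact: smooth_is_derive. Qed.

(** A curve is one order smoother than its derivative. Polynomials and solutions of linear equations
    become smooth by iterating this. *)
Lemma Ck_on_is_derive V (f g : R -> V) k : (forall t : R, is_derive t 1 f (g t)) ->
  Ck_on k setT g -> Ck_on k.+1 setT f.
Proof.
move=> fd gk; have df t : differentiable f t.
  by apply/derivable1_diffP; have [] := fd t.
split=> [t _|v]; first exact: df.
have : Ck_on k setT (fun t => v *: g t).
  by apply: Ck_onZ => //; [exact: openT|exact: Ck_on_cst].
apply: Ck_on_eq; first exact: openT.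
move=> t _; have [_ <-] := fd t; rewrite !deriveE//.
by rewrite -linearZ/=; congr ('d f t _); rewrite /GRing.scale/= mulr1.
Qed.

Lemma smooth_horner (P : {poly R}) : smooth (horner P).
Proof.
move=> k; elim: k P => [|k IH] P.
  by move=> x _; exact: continuous_horner.
by apply: (@Ck_on_is_derive _ _ (horner P^`())).
Qed.

End CurveDerivatives.

(** * Linear differential equations with constant coefficients *)

Section LinearODE.
Context {R : realType}.

(** Entrywise, so that the rules for real functions apply directly. *)
Definition mx_derive m n (M : R -> 'M[R]_(m, n)) (t : R) (D : 'M[R]_(m, n)) :=
  forall i j, is_derive t (1 : R) (fun s => M s i j) (D i j).

Lemma mx_derive_mul m n p (M : R -> 'M[R]_(m, n)) (N : R -> 'M[R]_(n, p)) (t : R)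
    (D : 'M[R]_(m, n)) (E : 'M[R]_(n, p)) :
  mx_derive M t D -> mx_derive N t E ->
  mx_derive (fun s => M s *m N s) t (D *m N t + M t *m E).
Proof.
move=> dM dN i j; rewrite !mxE -big_split/=.
have := is_derive_fsum (index_enum _) (fun l => is_derive_scale (dM i l) (dN l j)).
by move=> /is_derive_ext; apply => s; rewrite mxE.
Qed.

Lemma mx_derive_eq0 m n (M : R -> 'M[R]_(m, n)) :
  (forall t, mx_derive M t 0) -> forall t, M t = M 0.
Proof.
move=> dM t; apply/matrixP => i j.
apply: (@is_derive_0_is_cst _ (fun s => M s i j)) => s.
by have := dM s i j; rewrite mxE.
Qed.

(** [Q] is the exponential of [B]. For uniqueness, let [P t = Q (- t)], the inverse of [Q t]: since
    [B] commutes with [Q], the derivative of [P t *m f t] is zero. *)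
Lemma linear_ode m (B : 'M[R]_m) : exists Q : R -> 'M[R]_m,
  [/\ Q 0 = 1%:M, forall i j, smooth (fun s => Q s i j),
    forall t, mx_derive Q t (B *m Q t) &
    forall f : R -> 'cV[R]_m, (forall t, mx_derive f t (B *m f t)) ->
      forall t, f t = Q t *m f 0].
Proof.
have [Q [Q0 QB dQ]] := matrix_exponential B.
exists Q; split=> //.
  (* The equation writes the derivative of an entry as a combination of entries, so each round gains
     one order of smoothness. *)
  move=> i j k; elim: k i j => [|k IH] i j.
    move=> t _; apply: differentiable_continuous; apply/derivable1_diffP.
    by have [] := dQ t i j.
  apply: (Ck_on_is_derive (fun t => dQ t i j)).
  apply: (@Ck_on_eq _ _ _ _ _ (fun s => \sum_l B i l *: Q s l j)).
  - exact: openT.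
  - by move=> s _; rewrite mxE.
  - apply: Ck_on_sum; first exact: openT.
    by move=> l; apply: Ck_onZ; [exact: openT|exact: Ck_on_cst|exact: IH].
pose P s := Q (- s).
have dP t : mx_derive P t (- (P t *m B)).
  move=> i j; rewrite mxE -QB; exact: (is_derive_reverse (f := fun s => Q s i j)).
have QP t : Q t *m P t = 1%:M.
  rewrite (@mx_derive_eq0 _ _ (fun s => Q s *m P s)); first by rewrite /P oppr0 Q0 mulmx1.
  move=> s; have := mx_derive_mul (dQ s) (dP s).
  by rewrite mulmxN QB -!mulmxA /P QB subrr.
move=> f df t.
suff Pf : P t *m f t = f 0 by rewrite -Pf mulmxA QP mul1mx.
rewrite (@mx_derive_eq0 _ _ (fun s => P s *m f s)); first by rewrite /P oppr0 Q0 mul1mx.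
by move=> s; have := mx_derive_mul (dP s) (df s); rewrite mulNmx mulmxA addNr.
Qed.

End LinearODE.

(** * Higher derivatives of curves at a point *)

Section Jets.
Context {R : realType}.
Implicit Types u v w : R -> R.

Lemma derive1n_sum (V : normedModType R) (I : Type) (r : seq I) (f : I -> R -> V) k :
  (forall i, smooth (f i)) ->
  derive1n k (fun t => \sum_(i <- r) f i t) = fun t => \sum_(i <- r) derive1n k (f i) t.
Proof.
move=> sf; elim: k => [//|k IH]; rewrite derive1nS IH; apply/funext => t.
apply: derive1_is_derive; apply: is_derive_fsum => i.
exact: smooth_is_derive1 (smooth_derive1n k (sf i)).
Qed.

Lemma derive1nD (V : normedModType R) (f g : R -> V) k : smooth f -> smooth g ->
  derive1n k (fun t => f t + g t) = fun t => derive1n k f t + derive1n k g t.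
Proof.
move=> sf sg; elim: k => [//|k IH]; rewrite derive1nS IH; apply/funext => t.
apply: derive1_is_derive; apply: is_deriveD.
  exact: smooth_is_derive1 (smooth_derive1n k sf).
exact: smooth_is_derive1 (smooth_derive1n k sg).
Qed.

Lemma derive1n_lincomb (V : normedModType R) (I : Type) (r : seq I) (a : I -> R -> R)
    (b : I -> V) k : (forall i, smooth (a i)) ->
  derive1n k (fun t => \sum_(i <- r) a i t *: b i) =
    fun t => \sum_(i <- r) derive1n k (a i) t *: b i.
Proof.
move=> sa; rewrite derive1n_sum => [|i]; last by apply: smoothZ => //; exact: smooth_cst.
apply/funext => t; apply: eq_bigr => i _; elim: k t => [//|k IH] t.
rewrite derive1nS (_ : derive1n k _ = fun t => derive1n k (a i) t *: b i);
  last exact/funext.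
apply: derive1_is_derive.
have := is_derive_scale (smooth_is_derive1 t (smooth_derive1n k (sa i)))
  (is_derive_cst (b i) t 1).
by rewrite scaler0 addr0.
Qed.

Let horner_pow (t0 : R) q : horner (('X - t0%:P) ^+ q) = fun t => (t - t0) ^+ q.
Proof. by apply/funext => t; rewrite horner_exp hornerXsubC. Qed.

Let smooth_pow (t0 : R) q : smooth (fun t : R => (t - t0) ^+ q).
Proof. rewrite -horner_pow; exact: smooth_horner. Qed.

Let is_derive_pow (t0 t : R) q :
  is_derive t 1 (fun s : R => (s - t0) ^+ q.+1) (q.+1%:R * (t - t0) ^+ q).
Proof.
rewrite -horner_pow; apply: is_derive_eq.
rewrite deriv_exp derivXsubC mul1r/= hornerMn horner_exp hornerXsubC.
by rewrite mulr_natl.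
Qed.

(** By the product rule, differentiation lowers the order of vanishing by one and multiplies the
    leading coefficient by the old order. *)
Lemma vanishing_product (t0 : R) q u : smooth u ->
  exists2 r : R -> R, smooth r & r t0 = q.+1%:R * u t0 /\
  derive1 (fun t => (t - t0) ^+ q.+1 * u t) = fun t => (t - t0) ^+ q * r t.
Proof.
move=> su; exists (fun t => q.+1%:R * u t + (t - t0) * derive1 u t).
  apply: smoothD; first by apply: smoothM => //; exact: smooth_cst.
  apply: smoothM; last exact: smooth_derive1.
  by apply: smoothD; [exact: smooth_id|exact: smooth_cst].
split; first by rewrite subrr mul0r addr0.
apply/funext => t; apply: derive1_is_derive.
apply: is_derive_eq.
  exact: (is_derive_scale (is_derive_pow t0 t q) (smooth_is_derive1 t su)).
by rewrite /GRing.scale/= exprS; ring.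
Qed.

(** Iteration of the previous step, the factors [p], [p - 1], ... accumulating into a falling
    factorial. At [t0] the derivative is 0 for [k < p] and [p! w(t0)] for [k = p]. *)
Lemma derive1n_vanishing (t0 : R) p w k : smooth w -> (k <= p)%N ->
  exists2 r : R -> R, smooth r & r t0 = (p ^_ k)%:R * w t0 /\
  derive1n k (fun t => (t - t0) ^+ p * w t) = fun t => (t - t0) ^+ (p - k) * r t.
Proof.
move=> sw; elim: k => [_|k IH kp].
  by exists w => //; split; rewrite ?ffactn0 ?mul1r// subn0.
have [r sr [r0 rE]] := IH (ltnW kp).
have [r' sr' [r'0 r'E]] := vanishing_product t0 (p - k.+1) sr.
exists r' => //; split.
  by rewrite r'0 r0 subnSK// mulrA -natrM mulnC -ffactnSr.
by rewrite derive1nS rE -(subnSK kp).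
Qed.

(* The derivative of v vanishes to order p at t0, so only the Leibniz term
   with v undifferentiated survives there. *)
Lemma derive1n_mul_flat (t0 : R) p u v w k : smooth u -> smooth v -> smooth w ->
  derive1 v = (fun t => (t - t0) ^+ p * w t) -> (k <= p)%N ->
  derive1n k (fun t => u t * v t) t0 = derive1n k u t0 * v t0.
Proof.
move=> su sv sw vE kp.
(* The induction needs an identity valid for all [t], since it has to be differentiated; its
   remainder vanishes at [t0]. *)
suff [r sr ->] : exists2 r : R -> R, smooth r &
    derive1n k (fun t => u t * v t) =
      fun t => derive1n k u t * v t + (t - t0) ^+ (p - k).+1 * r t.
  by rewrite subrr exprS !mul0r addr0.
elim: k kp => [_|k IH kp].
  exists (fun=> 0); first exact: smooth_cst.
  by apply/funext => t; rewrite mulr0 addr0.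
have [r sr rE] := IH (ltnW kp).
have [r' sr' [_ r'E]] := vanishing_product t0 (p - k) sr.
(* The first term comes from differentiating [v]: of its factor [(t - t0) ^+ p], the power [p - k]
   is extracted and [k] is left. The second comes from the old remainder. *)
exists (fun t => derive1n k u t * (w t * (t - t0) ^+ k) + r' t).
  apply: smoothD => //; apply: smoothM; first exact: smooth_derive1n.
  by apply: smoothM => //; exact: smooth_pow.
rewrite derive1nS rE; apply/funext => t; apply: derive1_is_derive.
have s1 := smooth_derive1n k su.
have d1 := is_derive_scale (smooth_is_derive1 t s1) (smooth_is_derive1 t sv).
have sp : smooth (fun t => (t - t0) ^+ (p - k).+1 * r t).
  by apply: smoothM => //; exact: smooth_pow.
have d2 := smooth_is_derive1 t sp.
apply: (is_derive_ext (is_derive_eq (is_deriveD d1 d2) _)) => //.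
rewrite r'E vE -derive1nS /GRing.scale/= -addrA; congr (_ + _).
have -> : (t - t0) ^+ p = (t - t0) ^+ (p - k) * (t - t0) ^+ k.
  by rewrite -exprD subnK// ltnW.
by rewrite subnSK//; ring.
Qed.

(** The witness is the Taylor polynomial centred at [t0]. It makes every element of the jet space
    the jet of an actual curve. *)
Lemma derive1n_taylor p (c : 'I_p.+1 -> R) (t0 : R) :
  exists2 u : R -> R, smooth u & forall k : 'I_p.+1, derive1n k u t0 = c k.
Proof.
pose q := \poly_(k < p.+1) (c (inord k) / k`!%:R).
exists (horner (q \Po ('X - t0%:P))); first exact: smooth_horner.
move=> k; have dn j : derive1n j (horner (q \Po ('X - t0%:P))) =
    horner (q^`(j) \Po ('X - t0%:P)).
  elim: j => [//|j IH]; rewrite derive1nS IH -derivE deriv_comp.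
  by rewrite derivXsubC mulr1 derivnS.
rewrite dn horner_comp hornerXsubC subrr horner_coef0 coef_derivn addn0.
by rewrite coef_poly ltn_ord inord_val ffactnn -[LHS]mulr_natr divfK.
Qed.

End Jets.

(** * Transport of vector fields by a one-parameter group of diffeomorphisms *)

Section Flows.
Context {R : realType} {n : nat}.
Local Notation E := 'rV[R]_n.
Variable H : R -> E -> E.
Hypothesis smooth_H : smooth (fun tx : R * E => H tx.1 tx.2).
Hypothesis H0 : forall x, H 0 x = x.
Hypothesis HD : forall s t x, H (s + t) x = H s (H t x).

Let Y : vfield R n := fun x => derive1 (fun s => H s x) 0.
Let HH := fun tx : R * E => H tx.1 tx.2.

Let findim_RE : findim (R * E)%type.
Proof. by apply: findim_prod; [exact: findim_R|exact: findim_mx]. Qed.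

Let HK s : cancel (H s) (H (- s)).
Proof. by move=> x; rewrite -HD addNr H0. Qed.

Let smooth_slice (V : normedModType R) (f : R * E -> V) (a : R) :
  smooth f -> smooth (fun x => f (a, x)).
Proof.
move=> sf; apply: (smooth_comp (f := f)) => //.
by apply: smooth_pair; [exact: smooth_cst|exact: smooth_id].
Qed.

(** Rewrites a derivative in space as a directional derivative on the product with time, where the
    symmetry of second derivatives applies. *)
Let derive_slice (V : normedModType R) (f : R * E -> V) (a : R) (x v : E) :
  smooth f -> 'D_v (fun y => f (a, y)) x = 'D_((0, v)) f (a, x).
Proof.
move=> sf.
have sg : smooth (fun y : E => (a, y)).
  by apply: smooth_pair; [exact: smooth_cst|exact: smooth_id].
have [_ ->] := derive_comp v (smooth_differentiable x sg)
  (smooth_differentiable (a, x) sf).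
have dc : differentiable (cst a : E -> R) x by exact: differentiable_cst.
have di : differentiable (id : E -> E) x by [].
by rewrite (derive_pair v dc di) (derive_cst a x v) (derive_id x v).
Qed.

Lemma smooth_flow s : smooth (H s).
Proof. exact: (smooth_slice s smooth_H). Qed.

(** By the group law, the derivative at [t] is the derivative at 0 of the orbit of [H t x]. *)
Lemma is_derive_flow (t : R) x : is_derive t 1 (fun s => H s x) (Y (H t x)).
Proof.
have d0 : is_derive (0 : R) 1 (fun s => H s (H t x)) (Y (H t x)).
  have sH : smooth (fun s => H s (H t x)).
    apply: (smooth_comp (f := HH) (g := fun s => (s, H t x))) => //.
    by apply: smooth_pair; [exact: smooth_id|exact: smooth_cst].
  exact: smooth_is_derive1.
have sd : is_derive t 1 (fun s : R => s - t) 1 by exact: is_derive_shift.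
rewrite -(subrr t) in d0.
have := is_derive_reparam sd d0; rewrite scale1r => /is_derive_ext; apply => s.
by rewrite -HD subrK.
Qed.

Hypothesis smooth_Y : smooth Y.

(** The image of the [j]th basis vector under the differential of [H s] at [x], as a smooth function
    of the pair [(s, x)]. *)
Let K (j : 'I_n) : R * E -> E := 'D_((0, delta_mx 0 j)) HH.

Let smooth_K j : smooth (K j).
Proof. exact: smooth_derive. Qed.

Let derive_HE s x v : 'D_v (H s) x = \sum_j v 0 j *: K j (s, x).
Proof.
rewrite deriveE; last exact: (smooth_differentiable x (smooth_flow s)).
rewrite [in LHS](row_sum_delta v) linear_sum; apply: eq_bigr => j _.
rewrite linearZ/= -deriveE; last exact: (smooth_differentiable x (smooth_flow s)).
by congr (_ *: _); exact: (derive_slice s x _ smooth_H).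
Qed.

Let K0 j x : K j (0, x) = delta_mx 0 j.
Proof.
rewrite /K -(derive_slice 0 x _ smooth_H).
rewrite (_ : (fun y => _) = id); last by apply/funext => y; exact: H0.
by rewrite derive_id.
Qed.

(* The component in v does not contribute since K j is constant at time 0. *)
Let derive_K j y v : 'D_((1, v)) (K j) (0, y) = 'D_(delta_mx 0 j) Y y.
Proof.
have dK := smooth_differentiable (0, y) (smooth_K j).
have K0v : 'D_((0, v)) (K j) (0, y) = 0.
  rewrite -(derive_slice 0 y v (smooth_K j)).
  rewrite (_ : (fun y => _) = cst (delta_mx 0 j)); first exact: derive_cst.
  by apply/funext => x; exact: K0.
have v1 : (1, v) = (1, 0) + (0, v) :> R * E.
  by rewrite -[RHS]/(1 + 0, 0 + v) addr0 add0r.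
pose e1 : R * E := (1, 0); pose ej : R * E := (0, delta_mx 0 j).
rewrite (deriveE _ dK) v1 linearD/= -(deriveE _ dK) -(deriveE _ dK) K0v addr0.
(* After the exchange, the time derivative is taken first; at time 0 it is [Y]. *)
rewrite /K (@schwarz _ _ _ HH (0, y) ej e1 (@findim_mx R 1 n) smooth_H).
rewrite -(derive_slice 0 y (delta_mx 0 j) (smooth_derive e1 smooth_H)).
suff -> : (fun x : E => 'D_e1 HH (0, x)) = Y by [].
apply/funext => x; rewrite /Y derive1E.
have sg : smooth (fun s : R => (s, x)).
  by apply: smooth_pair; [exact: smooth_id|exact: smooth_cst].
have D1 : 'D_1 (fun s : R => (s, x)) 0 = e1.
  have dc : differentiable (cst x : R -> E) (0 : R) by exact: differentiable_cst.
  have di : differentiable (id : R -> R) 0 by [].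
  rewrite (derive_pair (1 : R) di dc) derive_id.
  by rewrite (derive_cst x (0 : R) (1 : R)).
have [_ D2] := derive_comp (1 : R) (smooth_differentiable 0 sg)
  (smooth_differentiable (0, x) smooth_H).
by move: D2; rewrite D1 => D2; exact: (esym D2).
Qed.

Definition transport (s : R) (X : vfield R n) : vfield R n :=
  Defs.pushforward (H s) (H (- s)) X.

Lemma transport0 X : transport 0 X = X.
Proof.
apply/funext => x; rewrite /transport /Defs.pushforward oppr0 H0.
rewrite (_ : H 0 = id) ?derive_id//; apply/funext => y; exact: H0.
Qed.

Lemma transport_sum (I : Type) (r : seq I) (c : I -> R) (X : I -> vfield R n) s x :
  transport s (fun y => \sum_(i <- r) c i *: X i y) x =
    \sum_(i <- r) c i *: transport s (X i) x.
Proof.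
have dH y : differentiable (H s) y by exact: (smooth_differentiable y (smooth_flow s)).
rewrite /transport /Defs.pushforward deriveE// linear_sum; apply: eq_bigr => i _.
by rewrite linearZ/= deriveE.
Qed.

(** The transported field at [y] is the sum over [j] of [X (H (- s) y) 0 j *: K j (s, H (- s) y)].
    In the product rule at 0, the first factors contribute [- 'D_(Y y) X y] and the second ones
    ['D_(X y) Y y]. *)
Let is_derive_transport0 (X : vfield R n) y : smooth X ->
  is_derive (0 : R) 1 (fun s => transport s X y) (bracket X Y y).
Proof.
move=> sX.
have back : is_derive (0 : R) 1 (fun s => H (- s) y) (- Y y).
  by have := is_derive_reverse (is_derive_flow (- 0) y); rewrite oppr0 H0.
have dX : is_derive (0 : R) 1 (fun s => X (H (- s) y)) (- 'D_(Y y) X y).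
  have dXy : differentiable X y by exact: smooth_differentiable.
  have := @is_derive_curve _ _ _ X _ 0 _ back; rewrite oppr0 H0 => /(_ dXy).
  by rewrite (deriveE _ dXy) linearN/= -(deriveE _ dXy).
have dXj j : is_derive (0 : R) 1 (fun s => X (H (- s) y) 0 j)
    ((- 'D_(Y y) X y) 0 j).
  have sc : smooth (fun M : E => M 0 j) by exact: smooth_coord.
  have lc : linear (fun M : E => M 0 j) by move=> a u v; rewrite !mxE.
  pose L : {linear E -> R} := HB.pack (fun M : E => M 0 j)
    (GRing.isLinear.Build _ _ _ _ _ lc).
  by apply: (@is_derive_lin _ _ _ _ L) => //; exact: smooth_continuous sc.
have dK j : is_derive (0 : R) 1 (fun s => K j (s, H (- s) y))
    ('D_(delta_mx 0 j) Y y).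
  have dc : is_derive (0 : R) 1 (fun s : R => (s, H (- s) y)) (1, - Y y).
    have [db dbE] := back.
    have d1 : differentiable (fun s => H (- s) y) 0 by exact/derivable1_diffP.
    have d2 : differentiable (fun s : R => (s, H (- s) y)) 0.
      exact: differentiable_pair.
    apply: DeriveDef; first exact/derivable1_diffP.
    by rewrite derive_pair// dbE derive_id.
  have := @is_derive_curve _ _ _ (K j) _ 0 _ dc (smooth_differentiable _ (smooth_K j)).
  by rewrite oppr0 H0 derive_K.
have := is_derive_fsum (index_enum _) (fun j => is_derive_scale (dXj j) (dK j)).
move=> /is_derive_ext-/(_ (fun s => transport s X y)) D.
apply: (is_derive_eq (D _)).
  by move=> s; rewrite /transport /Defs.pushforward derive_HE.
rewrite oppr0 H0 big_split/= addrC.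
under [X in _ + X]eq_bigr do rewrite K0.
rewrite -row_sum_delta /bracket; congr (_ - _).
have dY : differentiable Y y by exact: smooth_differentiable.
rewrite deriveE// [in RHS](row_sum_delta (X y)) linear_sum; apply: eq_bigr => j _.
by rewrite linearZ/= deriveE.
Qed.

(** By the group law, transport by [s + r] is transport by [r] followed by the fixed linear map
    ['d (H s) y]; this reduces the derivative at [s] to the one at 0. *)
Lemma is_derive_transport (X : vfield R n) (s : R) x : smooth X ->
  is_derive s 1 (fun s => transport s X x) (transport s (bracket X Y) x).
Proof.
move=> sX; set y := H (- s) x.
have dH z : differentiable (H s) z by exact: (smooth_differentiable z (smooth_flow s)).
have tD r : transport (s + r) X x = 'd (H s) y (transport r X y).
  rewrite /transport /Defs.pushforward -deriveE//.
  have Hr : H (- (s + r)) x = H (- r) y by rewrite opprD addrC HD.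
  rewrite Hr; have -> : H (s + r) = fun z => H s (H r z) by apply/funext => z; exact: HD.
  have dr := smooth_differentiable (H (- r) y) (smooth_flow r).
  have [_ ->] := derive_comp (X (H (- r) y)) dr (dH (H r (H (- r) y))).
  by have -> : H r (H (- r) y) = y by rewrite -{1}[r]opprK HK.
have d0 := is_derive_lin (diff_continuous (dH y)) (is_derive_transport0 y sX).
have sd : is_derive s 1 (fun r : R => r - s) 1 by exact: is_derive_shift.
rewrite -(subrr s) in d0.
have := is_derive_reparam sd d0; rewrite scale1r => d1.
apply: (is_derive_ext (is_derive_eq d1 _)) => [|r].
  by rewrite /transport /Defs.pushforward (deriveE _ (dH y)).
by rewrite -tD addrC subrK.
Qed.

(** For a fixed point and a fixed component, the transports of the [e i] form a column that solves
    the linear equation of matrix [B]. The solution matrix [Q] is thus the same at all points. *)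
Lemma transport_linear m (e : 'I_m -> vfield R n) (B : 'M[R]_m) :
  (forall i, smooth (e i)) ->
  (forall i, bracket (e i) Y = fun x => \sum_j B i j *: e j x) ->
  exists Q : R -> 'M[R]_m, [/\ Q 0 = 1%:M, forall i j, smooth (fun s => Q s i j),
    forall i j, is_derive (0 : R) 1 (fun s => Q s i j) (B i j) &
    forall s i x, transport s (e i) x = \sum_j Q s i j *: e j x].
Proof.
move=> se eB; have [Q [Q0 sQ dQ QU]] := linear_ode B.
exists Q; split=> //.
  by move=> i j; have := dQ 0 i j; rewrite Q0 mulmx1.
move=> s i x; apply/rowP => c.
pose f s : 'cV[R]_m := \col_i transport s (e i) x 0 c.
have df t : mx_derive f t (B *m f t).
  move=> k l; rewrite mxE.
  have lc : linear (fun M : E => M 0 c) by move=> a u v; rewrite !mxE.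
  pose L : {linear E -> R} := HB.pack (fun M : E => M 0 c)
    (GRing.isLinear.Build _ _ _ _ _ lc).
  have cL : continuous L.
    by have := smooth_continuous (@smooth_coord R 1 n 0 c).
  have := is_derive_lin cL (is_derive_transport t x (se k)).
  rewrite eB transport_sum linear_sum/= => d.
  apply: (is_derive_ext (is_derive_eq d _)) => [|r]; last by rewrite mxE.
  by apply: eq_bigr => j _; rewrite !mxE.
have := QU f df s; move=> /matrixP/(_ i 0); rewrite !mxE => ->.
by rewrite summxE; apply: eq_bigr => j _; rewrite !mxE transport0.
Qed.

End Flows.

(** * Invariance of [phi] on jets under reparametrised flows *)

Section JetInvariance.
Context {R : realType} {n : nat}.
Local Notation E := 'rV[R]_n.
Variables (W V : set (vfield R n)) (F : (R -> vfield R n) -> (R -> R)) (p : nat).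
Variable phi : ('I_p.+1 -> vfield R n) -> R.
Hypothesis scheme : quasi_lie_scheme W V.
Hypothesis invariant_F : quasi_lie_invariant W V F.
Hypothesis order_F : has_order V F phi.

Variable H : R -> E -> E.
Hypothesis smooth_H : smooth (fun tx : R * E => H tx.1 tx.2).
Hypothesis H0 : forall x, H 0 x = x.
Hypothesis HD : forall s t x, H (s + t) x = H s (H t x).

Let Y : vfield R n := fun x => derive1 (fun s => H s x) 0.
Hypothesis WY : W Y.

Let lincomb m (e : 'I_m -> vfield R n) (c : 'M[R]_(p.+1, m)) : 'I_p.+1 -> vfield R n :=
  fun k => \sum_i c k i *: e i.

Let sumvE m (c : 'I_m -> R) (e : 'I_m -> vfield R n) x :
  (\sum_i c i *: e i) x = \sum_i c i *: e i x.
Proof. by rewrite fct_sumE. Qed.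

Let findim_RE : findim (R * E)%type.
Proof. by apply: findim_prod; [exact: findim_R|exact: findim_mx]. Qed.

Let tdep_lincomb (U : set (vfield R n)) m (e : 'I_m -> vfield R n) (a : 'I_m -> R -> R) :
  (forall c : 'I_m -> R, U (\sum_i c i *: e i)) -> (forall i, smooth (e i)) ->
  (forall i, smooth (a i)) -> tdep_field U (fun t x => \sum_i a i t *: e i x).
Proof.
move=> Ue se sa; split=> [|t].
  apply: smooth_sum => i; apply: smoothZ.
    apply: (smooth_comp (f := a i) (g := fst)) => //; [exact: findim_R|exact: smooth_fst].
  apply: (smooth_comp (f := e i) (g := snd)) => //; [exact: findim_mx|exact: smooth_snd].
rewrite (_ : (fun x => _) = \sum_i a i t *: e i)//.
by apply/funext => x; rewrite sumvE.
Qed.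

Let jet_lincomb m (e : 'I_m -> vfield R n) (a : 'I_m -> R -> R) t :
  (forall i, smooth (a i)) ->
  jet p (fun t x => \sum_i a i t *: e i x) t =
    lincomb e (\matrix_(k, i) derive1n k (a i) t).
Proof.
move=> sa; apply/funext => k; apply/funext => x; rewrite /jet /lincomb sumvE.
by rewrite derive1n_lincomb//; apply: eq_bigr => i _; rewrite mxE.
Qed.

Let WZ a : W (a *: Y).
Proof.
have [[[[m [e WE]] _] _] _ _ _] := scheme.
move: WY; rewrite WE => -[c ->]; exists (fun i => a * c i).
by rewrite scaler_sumr; apply: eq_bigr => i _; rewrite scalerA.
Qed.

(** By the chain rule this is the flow of the field [T' Y], which stays in [W] because [W] is a
    vector space. *)
Let generalised_flow_reparam (T : {poly R}) : T.[0] = 0 ->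
  generalised_flow W (fun t => H T.[t]) (fun t => H (- T.[t])).
Proof.
move=> T0; have [[[_ Wsm] _] _ _ _] := scheme.
have sT (P : {poly R}) : smooth (fun tx : R * E => P.[tx.1]).
  apply: (smooth_comp (f := horner P)); [exact: findim_R|exact: smooth_horner|].
  exact: smooth_fst.
have sHT (P : {poly R}) : smooth (fun tx : R * E => H P.[tx.1] tx.2).
  apply: (smooth_comp (f := fun tx : R * E => H tx.1 tx.2)
    (g := fun tx : R * E => (P.[tx.1], tx.2))) => //.
  by apply: smooth_pair => //; exact: smooth_snd.
split.
- exact: sHT.
- have := sHT (- T).
  rewrite (_ : (fun tx => _) = fun tx : R * E => H (- T.[tx.1]) tx.2)//.
  by apply/funext => tx; rewrite hornerN.
- by move=> t; split=> x; rewrite -HD ?addNr ?subrr H0.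
- by move=> x; rewrite T0 H0.
- exists (fun t => T^`().[t] *: Y); first split=> [|t]; [|exact: WZ|].
    apply: (smoothZ (f := fun tx : R * E => T^`().[tx.1])
      (g := fun tx : R * E => Y tx.2)); first exact: sT.
    apply: (smooth_comp (f := Y) (g := snd)); [exact: findim_mx|exact: Wsm|].
    exact: smooth_snd.
  move=> t x.
  exact: (is_derive_reparam (is_derive_poly T t) (is_derive_flow smooth_H HD T.[t] x)).
Qed.

(** Jets are encoded by matrices with one row per order of derivative, on which transport acts by
    right multiplication by [Q]. Both actions of the theorem are obtained by suitable choices of
    [T], [w] and [t0]. *)
Lemma jet_invariance :
  exists m (e : 'I_m -> vfield R n) (y : 'I_m -> R) (B : 'M[R]_m) (Q : R -> 'M[R]_m),
  [/\ V = [set X | exists c : 'I_m -> R, X = \sum_(i < m) c i *: e i] /\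
        Y = \sum_i y i *: e i,
      Q 0 = 1%:M /\ mx_derive Q 0 B,
      forall s (c : 'I_m -> R) x, transport H s (\sum_i c i *: e i) x =
        \sum_j (\sum_i c i * Q s i j) *: e j x &
      forall (T w : {poly R}) (t0 : R) (c : 'M[R]_(p.+1, m)), T.[0] = 0 ->
        T^`() = ('X - t0%:P) ^+ p * w ->
        phi (lincomb e (c *m Q T.[t0] +
          \matrix_(k, j) (if k == ord_max then p`!%:R * w.[t0] * y j else 0))) =
        phi (lincomb e c)].
Proof.
have [[[_ Wsm] [[m [e VE]] Vsm]] _ WV WVV] := scheme.
have Ve (c : 'I_m -> R) : V (\sum_i c i *: e i) by rewrite VE; exists c.
have Vei i : V (e i).
  rewrite VE; exists (fun j => (j == i)%:R); rewrite (bigD1 i)//= eqxx scale1r.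
  by rewrite big1 ?addr0// => j /negPf ->; rewrite scale0r.
have se i : smooth (e i) by exact: Vsm.
have [y yE] : exists y, Y = \sum_i y i *: e i by have := WV _ WY; rewrite VE.
have bracketV i : exists b : 'I_m -> R, bracket (e i) Y = \sum_j b j *: e j.
  have := WVV _ _ WY (Vei i); rewrite VE => -[b bE].
  (* The scheme puts [bracket Y (e i)] in [V], whereas differentiating the transport produces
     [bracket (e i) Y]; hence the sign. *)
  exists (fun j => - b j); apply/funext => x.
  have -> : bracket (e i) Y x = - bracket Y (e i) x by rewrite /bracket opprB.
  by rewrite bE !sumvE -sumrN; apply: eq_bigr => j _; rewrite scaleNr.
have [b bE] := choice bracketV.
have bB i : bracket (e i) Y = fun x => \sum_j (\matrix_(i, j) b i j) i j *: e j x.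
  by rewrite bE; apply/funext => x; rewrite sumvE; apply: eq_bigr => j _; rewrite mxE.
have [Q [Q0 sQ dQ tQ]] := transport_linear smooth_H H0 HD (Wsm _ WY) se bB.
have tE s (c : 'I_m -> R) x : transport H s (\sum_i c i *: e i) x =
    \sum_j (\sum_i c i * Q s i j) *: e j x.
  rewrite (_ : \sum_i c i *: e i = fun x => \sum_i c i *: e i x); last first.
    by apply/funext => z; rewrite sumvE.
  rewrite (transport_sum smooth_H).
  under [RHS]eq_bigr do rewrite scaler_suml.
  rewrite exchange_big/=; apply: eq_bigr => i _.
  by rewrite tQ scaler_sumr; apply: eq_bigr => j _; rewrite scalerA.
exists m, e, y, (\matrix_(i, j) b i j), Q; split=> //.
move=> T w t0 c T0 dT.
(* Coefficients of a field [X] whose jet at [t0] is the given [c]. *)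
have /choice[x xP] i : exists u : R -> R,
    smooth u /\ forall k : 'I_p.+1, derive1n k u t0 = c k i.
  by have [u su uE] := derive1n_taylor (fun k => c k i) t0; exists u.
have sx i : smooth (x i) by have [] := xP i.
pose X t : vfield R n := fun z => \sum_i x i t *: e i z.
have tX : tdep_field V X by exact: tdep_lincomb.
pose QT i j t := Q T.[t] i j.
have sQT i j : smooth (QT i j).
  apply: (smooth_comp (f := fun s => Q s i j) (g := horner T)) => //.
    exact: findim_R.
  exact: smooth_horner.
(* Coefficients of the transformed field: the velocity [T' Y] of the flow plus the transport of
   [X]. *)
pose a j t := T^`().[t] * y j + \sum_i x i t * QT i j t.
have sTy j : smooth (fun t => T^`().[t] * y j).
  by apply: smoothM; [exact: smooth_horner|exact: smooth_cst].
have sxQ j : smooth (fun t => \sum_i x i t * QT i j t).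
  by apply: smooth_sum => i; exact: smoothM.
have sa j : smooth (a j) by exact: smoothD.
have flow := generalised_flow_reparam T0.
have starE : star (fun t => H T.[t]) (fun t => H (- T.[t])) X =
    fun t z => \sum_j a j t *: e j z.
  apply/funext => t; apply/funext => z; rewrite /star.
  have HK : H T.[t] (H (- T.[t]) z) = z by rewrite -HD subrr H0.
  rewrite -[Defs.pushforward _ _ _ _]/(transport H T.[t] (X t) z).
  rewrite /X (_ : (fun z => _) = \sum_i x i t *: e i); last first.
    by apply/funext => z'; rewrite sumvE.
  rewrite tE.
  have dg := is_derive_reparam (is_derive_poly T t)
    (is_derive_flow smooth_H HD T.[t] (H (- T.[t]) z)).
  rewrite (derive1_is_derive dg).
  rewrite HK -/(Y z) yE sumvE scaler_sumr -big_split/=.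
  by apply: eq_bigr => j _; rewrite /a scalerDl scalerA.
have tstar : tdep_field V (star (fun t => H T.[t]) (fun t => H (- T.[t])) X).
  by rewrite starE; exact: tdep_lincomb.
have [_ /(_ _ _ _ flow tX) FE] := invariant_F.
have [_ phiE] := order_F.
have := congr1 (fun f => f t0) FE; rewrite !phiE// starE !jet_lincomb//.
have -> : \matrix_(k, i) derive1n k (x i) t0 = c.
  by apply/matrixP => k i; rewrite mxE; have [_ ->] := xP i.
move=> <-; congr (phi (lincomb e _)); apply/matrixP => k j; rewrite !mxE.
have kp : (k <= p)%N by rewrite -ltnS.
rewrite derive1nD// derive1n_sum; last by move=> i; exact: smoothM.
rewrite addrC; congr (_ + _).
  (* Velocity term: because of the factor [(t - t0) ^+ p], only the row of order [p] can be nonzero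
     at [t0]. *)
  rewrite (_ : (fun t => T^`().[t] * y j) = (fun t => (t - t0) ^+ p * (w.[t] * y j))).
    have [|r sr [r0 ->]] := derive1n_vanishing (w := fun t => w.[t] * y j) t0 _ kp.
      by apply: smoothM; [exact: smooth_horner|exact: smooth_cst].
    rewrite subrr r0; have [kE|kE] := eqVneq k ord_max.
      by rewrite kE/= subnn expr0 mul1r ffactnn mulrA.
    have kp' : (k : nat) != p by [].
    by rewrite expr0n subn_eq0 leqNgt ltn_neqAle kp' kp mul0r.
  by apply/funext => t; rewrite dT hornerM horner_exp hornerXsubC mulrA.
(* Transport term: the derivative of [QT i j] also carries [(t - t0) ^+ p], so up to order [p] this
   factor behaves like the constant [Q T.[t0] i j]. *)
apply: eq_bigr => i _; have [_ xE] := xP i.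
have [r sr rE] : exists2 r : R -> R, smooth r &
    derive1 (QT i j) = fun t => (t - t0) ^+ p * r t.
  exists (fun t => w.[t] * derive1 (fun s => Q s i j) T.[t]).
    apply: smoothM; first exact: smooth_horner.
    apply: (smooth_comp (f := derive1 (fun s => Q s i j)) (g := horner T)).
    - exact: findim_R.
    - exact: smooth_derive1.
    - exact: smooth_horner.
  apply/funext => t.
  rewrite (derive1_comp (f := horner T) (g := fun s => Q s i j)).
  - by rewrite -derivE dT hornerM horner_exp hornerXsubC mulrC mulrA.
  - exact: derivable_horner.
  - by have [] := smooth_is_derive1 T.[t] (sQ i j).
by rewrite (derive1n_mul_flat (sx i) (sQT i j) sr rE kp) xE.
Qed.

End JetInvariance.

(** * One-parameter subgroups and the flows they generate *)

Section OneParameterSubgroups.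
Context {R : realType} {G : topGroupType} {d : nat} {A : set (chart R G d)}.
Variable gamma : R -> G.
Hypothesis sub_gamma : one_parameter_subgroup A gamma.

Lemma one_parameter0 : gamma 0 = 1%g.
Proof.
have [_ gD] := sub_gamma; have := gD 0 0; rewrite addr0 => g00.
by rewrite -(mulVg (gamma 0)) {3}g00 mulgA mulVg mul1g.
Qed.

Lemma one_parameterN s : gamma (- s) = (gamma s)^-1%g.
Proof.
have [_ gD] := sub_gamma; have := gD s (- s); rewrite subrr one_parameter0 => gN.
by rewrite -[RHS]mulg1 gN mulgA mulVg mul1g.
Qed.

(** The action is known to be smooth only through charts of [G]. Near a time [t], [gamma] stays in
    the domain of a chart around [gamma t], and the flow factors through its coordinates. *)
Lemma smooth_one_parameter_flow n (Phi : G -> 'rV[R]_n -> 'rV[R]_n) :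
  smooth_manifold A -> smooth_action A Phi ->
  smooth (fun tx : R * 'rV[R]_n => Phi (gamma tx.1) tx.2).
Proof.
move=> manA actA k; apply: Ck_on_local => -[t x] _.
have [[cg sg] _] := sub_gamma.
have [c Ac ct] := manifold_cover manA (gamma t).
pose T : set R := setT `&` gamma @^-1` cdom c.
have oT : open T.
  rewrite /T setTI; apply: open_comp (open_cdom c) => s _; exact: cg.
pose D : set (R * 'rV[R]_n) := fst @^-1` T.
have oD : open D by apply: open_comp oT => -[s y] _; exact: cvg_fst.
exists D; first by split.
have gk : Ck_on k D (fun tx => Defs.coord c (gamma tx.1)).
  apply: (@Ck_on_comp _ _ _ _ _ D T (Defs.coord c \o gamma) fst) => //.
  - exact: findim_R.
  - exact: (sg c Ac k).
  - exact: Ck_on_sub (@smooth_fst _ _ _ k).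
have sk : Ck_on k D (snd : R * 'rV[R]_n -> _) by exact: Ck_on_sub (@smooth_snd _ _ _ k).
apply: (@Ck_on_eq _ _ _ _ _
  (fun tx => Phi (param c (Defs.coord c (gamma tx.1))) tx.2)) => //.
  by move=> [s y] [_ /= Ds]; rewrite coordK.
apply: (@Ck_on_comp _ _ _ _ _ D (cimg c `*` setT)
  (fun ux : 'rV[R]_d * 'rV[R]_n => Phi (param c ux.1) ux.2)
  (fun tx => (Defs.coord c (gamma tx.1), tx.2))) => //.
- by apply: findim_prod; exact: findim_mx.
- by move=> [s y] [_ /= Ds]; split=> //; exists (gamma s).
- exact: (action_smooth actA Ac k).
- exact: Ck_on_pair.
Qed.

End OneParameterSubgroups.

(** * From invariance under the actions to first integrals *)

Lemma is_derive_smooth_mx (R : realType) m n (f : 'M[R]_(m, n) -> R)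
    (M : R -> 'M[R]_(m, n)) (t : R) (D : 'M[R]_(m, n)) :
  smooth f -> mx_derive M t D ->
  is_derive t 1 (fun s => f (M s)) ('D_D f (M t)).
Proof.
move=> sf dM; have Mt : derivable M t 1.
  by apply/derivable_mxP => i j; have [] := dM i j.
have dMt : is_derive t 1 M D.
  apply: DeriveDef => //; rewrite derive_mx//; apply/matrixP => i j.
  by rewrite mxE; have [] := dM i j.
exact: (is_derive_curve dMt (smooth_differentiable _ sf)).
Qed.

Theorem theorem9p6 (R : realType) (n : nat) (W V : set (vfield R n))
    (F : (R -> vfield R n) -> (R -> R)) (p : nat)
    (phi : ('I_p.+1 -> vfield R n) -> R)
    (G : topGroupType) (d : nat) (A : set (chart R G d))
    (Phi : G -> 'rV[R]_n -> 'rV[R]_n) :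
  quasi_lie_scheme W V ->
  lie_group A ->
  connected [set: G]%classic ->
  smooth_action A Phi ->
  has_lie_algebra A Phi W ->
  quasi_lie_invariant W V F ->
  has_order V F phi ->
  (forall Z, VJ A Phi p Z -> first_integral V Z phi) /\
  (forall Z, VT p W Z -> first_integral V Z phi).
Proof.
move=> scheme lieG _ actA [funA _ surjA] invF ordF.
have [sphi _] := ordF.
have flow gamma : one_parameter_subgroup A gamma ->
  [/\ smooth (fun tx : R * 'rV[R]_n => Phi (gamma tx.1) tx.2),
      forall x, Phi (gamma 0) x = x &
      forall s t x, Phi (gamma (s + t)) x = Phi (gamma s) (Phi (gamma t) x)].
  move=> gA; split=> [|x|s t x].
  - exact: smooth_one_parameter_flow (lie_manifold lieG) actA.
  - by rewrite (one_parameter0 gA) (action1 actA).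
  - by have [_ ->] := gA; rewrite (actionM actA).
have coords m (e : 'I_m -> vfield R n) (q : 'I_p.+1 -> vfield R n) :
    V = [set X | exists c : 'I_m -> R, X = \sum_(i < m) c i *: e i] ->
    jet_space V q ->
    exists c : 'M[R]_(p.+1, m), q = fun k => \sum_i c k i *: e i.
  move=> -> /choice[c cE]; exists (\matrix_(k, i) c k i); apply/funext => k.
  by rewrite cE; apply: eq_bigr => i _; rewrite mxE.
have Vbasis m (e : 'I_m -> vfield R n) i :
    V = [set X | exists c : 'I_m -> R, X = \sum_(i < m) c i *: e i] -> V (e i).
  move=> ->; exists (fun j => (j == i)%:R); rewrite (bigD1 i)//= eqxx scale1r.
  by rewrite big1 ?addr0// => j /negPf ->; rewrite scale0r.
split=> Z.
  case=> gamma gA -> q qV.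
  have [sH H0 HD] := flow gamma gA.
  have [m [e [y [B [Q [[VE _] [Q0 dQ] tQ inv]]]]]] :=
    jet_invariance scheme invF ordF sH H0 HD (funA _ gA).
  have [c qE] := coords m e q VE qV.
  (* In coordinates the orbit of [c] is [c *m Q s], with velocity [c *m B] at 0. *)
  have ZE : jet_fundamental (fun s => jet_act Phi (gamma s)) q =
      fun k => \sum_j (c *m B) k j *: e j.
    apply/funext => k; apply/funext => x; rewrite /jet_fundamental fct_sumE.
    apply: derive1_is_derive.
    have dc j : is_derive (0 : R) 1 (fun s => \sum_i c k i * Q s i j) ((c *m B) k j).
      rewrite mxE; apply: is_derive_fsum => i.
      have := is_derive_scale (is_derive_cst (c k i) (0 : R) 1) (dQ i j).
      by rewrite scale0r add0r.
    have := is_derive_fsum (index_enum _)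
      (fun j => is_derive_scale (dc j) (is_derive_cst (e j x) (0 : R) 1)).
    move=> D; apply: (is_derive_ext (is_derive_eq D _)) => [|s].
      by apply: eq_bigr => j _; rewrite scaler0 addr0.
    by rewrite -tQ /jet_act -(one_parameterN gA) qE.
  split; first by move=> k; rewrite ZE VE; exists (fun j => (c *m B) k j).
  rewrite ZE; pose f (c : 'M[R]_(p.+1, m)) := phi (fun k => \sum_i c k i *: e i).
  have sf : smooth f by apply: sphi => i; exact: (Vbasis m e i VE).
  have fQ s : f (c *m Q s) = f c.
    (* The exponent [p.+2] leaves in [T'] one factor ['X - 1] beyond the required [p], so [w]
       vanishes at 1 and no vertical shift appears. The sign [(-1) ^+ p] makes [T] vanish at 0. *)
    pose T : {poly R} := s%:P * (1 - (-1) ^+ p *: ('X - 1%:P) ^+ p.+2).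
    pose w : {poly R} := - (s * (-1) ^+ p * p.+2%:R) *: ('X - 1%:P).
    have TE t : T.[t] = s * (1 - (-1) ^+ p * (t - 1) ^+ p.+2).
      rewrite /T hornerM !hornerC hornerD hornerN hornerZ horner_exp.
      by rewrite hornerXsubC !hornerC.
    have T1 : T.[1] = s.
      by rewrite TE subrr expr0n/= mulr0 subr0 mulr1.
    have T0 : T.[0] = 0.
      rewrite TE sub0r exprS exprS mulrA mulrNN mulr1 mul1r.
      by rewrite -exprMn mulrNN mulr1 expr1n subrr mulr0.
    have w1 : w.[1] = 0 by rewrite /w !hornerE subrr mulr0.
    have dT : T^`() = ('X - 1%:P) ^+ p * w.
      rewrite /T /w derivM derivC mul0r add0r derivB derivC derivZ deriv_exp.
      rewrite derivXsubC mul1r sub0r/= -mulr_natl -!mul_polyC -polyC_natr.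
      rewrite !polyCN !polyCM !exprS; ring.
    have := inv T w 1 c T0 dT; rewrite T1 w1.
    rewrite (_ : \matrix_(k, j) _ = 0) ?addr0//.
    by apply/matrixP => k j; rewrite !mxE mulr0 mul0r if_same.
  have dcQ : mx_derive (fun s => c *m Q s) 0 (c *m B).
    have dc : mx_derive (fun _ : R => c) 0 0.
      by move=> i j; rewrite mxE; exact: is_derive_cst.
    by have := mx_derive_mul dc dQ; rewrite mul0mx add0r.
  (* Since [f] is smooth, its constancy along the orbit annihilates the derivative in the direction
     of the velocity, hence also the derivative along the straight line in [first_integral]. *)
  have D0 : 'D_(c *m B) f c = 0.
    have := is_derive_smooth_mx sf dcQ; rewrite Q0 mulmx1 => -[_ <-].
    by rewrite (_ : (fun s => _) = cst (f c)) ?derive_cst//; exact/funext.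
  have := is_derive_line c (c *m B) 0 sf; rewrite scale0r addr0 D0.
  move=> /is_derive_ext; apply => s; congr phi; apply/funext => k.
  rewrite qE -[(_ + _) k]/(\sum_i c k i *: e i + s *: \sum_j (c *m B) k j *: e j).
  rewrite scaler_sumr -big_split/=; apply: eq_bigr => i _.
  by rewrite !mxE scalerDl scalerA.
case=> Y' [WY' Y'0] -> q qV.
(* The fundamental field of a translation is constant. *)
have ZE : jet_fundamental (fun s => vertical_act (s *: Y')) q = Y'.
  apply/funext => k; apply/funext => x; apply: derive1_is_derive.
  have := is_derive_scale (is_derive_id (0 : R) 1) (is_derive_cst (Y' k x) (0 : R) 1).
  rewrite scale1r scaler0 addr0 => D.
  have := is_deriveD D (is_derive_cst (q k x) (0 : R) 1); rewrite addr0.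
  by move=> /is_derive_ext; apply.
have [_ _ WV _] := scheme.
rewrite /first_integral ZE; split; first by move=> k; exact/WV/WY'.
(* The top component is the only one of [Y'] that may be nonzero; it is an element of [W], hence
   generated by a one-parameter subgroup. *)
have [gamma gA gE] := surjA _ (WY' ord_max).
have [sH H0 HD] := flow gamma gA.
have [m [e [y [B [Q [[VE yE] [Q0 _] _ inv]]]]]] :=
  jet_invariance scheme invF ordF sH H0 HD (funA _ gA).
have [c qE] := coords m e q VE qV.
suff -> : (fun s : R => phi (q + s *: Y')) = cst (phi q) by exact: is_derive_cst.
apply/funext => s /=.
(* Here [T' = s t^p / p!], so the shift [p! w(0)] is exactly [s]. As [T 0 = 0], the transport at
   [t0 = 0] is the identity, and [phi] is constant on the whole line. *)
pose T : {poly R} := (s / p.+1`!%:R) *: 'X^(p.+1).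
pose w : {poly R} := (s / p`!%:R)%:P.
have T0 : T.[0] = 0 by rewrite /T !hornerE expr0n/= mulr0.
have dT : T^`() = ('X - 0%:P) ^+ p * w.
  rewrite /T /w subr0 derivZ derivXn/= -scalerMnr scalerMnl [RHS]mulrC mul_polyC.
  rewrite -mulr_natr; congr (_ *: _).
  by rewrite factS natrM invfM mulrA mulrAC mulfVK// pnatr_eq0.
have := inv T w 0 c T0 dT; rewrite T0 Q0 mulmx1 -qE => <-.
congr phi; apply/funext => k; apply/funext => x.
rewrite -[LHS]/(q k x + s *: Y' k x) qE !fct_sumE.
have [->|kp] := eqVneq k ord_max.
  rewrite -gE (_ : fundamental_field Phi gamma = \sum_i y i *: e i)//.
  rewrite fct_sumE scaler_sumr -big_split/=.
  apply: eq_bigr => i _; rewrite !mxE eqxx /w hornerC scalerDl scalerA.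
  by congr (_ + (_ * _) *: _); rewrite mulrCA mulfV ?mulr1// pnatr_eq0 -lt0n fact_gt0.
have kp' : (k < p)%N by rewrite ltn_neqAle -ltnS ltn_ord andbT; exact: kp.
rewrite (Y'0 k kp') [s *: _]scaler0 addr0; apply: eq_bigr => i _.
by rewrite !mxE (negPf kp) addr0.
Qed.
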